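(* Let $t \ge 0$, $n \ge 1$ and $\ell \ge 0$ be integers such that, if $t \ne 1$, $n \ge 2^{2 + 6/(t-1)}\,\ell$ (for $t=1$ no such condition is imposed). Then for every integer $m$ with $0 \le m \le \binom{n}{2} - \binom{n-\ell}{2}$, the lexicographic graph $\mathcal{L}_{n,2}(m)$ maximises $\mathrm{int}(G,t)$ over all graphs $G$ on $[n]$ with $m$ edges.
   Context: $[n]=\{1,\dots,n\}$; a graph on $[n]$ is identified with its edge set, a subset of $\binom{[n]}{2}$, the set of $2$-element subsets of $[n]$. A family of sets is intersecting if any two of its members have non-empty intersection (the empty family is intersecting). $\mathrm{int}(G,t)$ is the number of intersecting subfamilies of the edge set of $G$ consisting of exactly $t$ edges. The lexicographic order on $\binom{[n]}{2}$ is: for $A\neq B$, $A<B$ if $\min(A \triangle B) \in A$. $\mathcal{L}_{n,2}(m)$ is the graph formed by the first $m$ pairs in this order. Convention: $\binom{x}{2} = 0$ for integers $x<2$. *)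

(* Defs.v *)
From mathcomp Require Import all_boot.

Set Implicit Arguments.
Unset Strict Implicit.
Unset Printing Implicit Defensive.

(* The ground set [n] is rendered as 'I_n = {0, ..., n-1}, with its usual
   order; a graph on [n] is its edge set G : {set {set 'I_n}}, required to
   satisfy G \subset pairs n. *)
Definition pairs (n : nat) : {set {set 'I_n}} :=
  [set A : {set 'I_n} | #|A| == 2].

Definition intersecting (n : nat) (F : {set {set 'I_n}}) : bool :=
  [forall A in F, forall B in F, A :&: B != set0].

Definition int_count (n : nat) (G : {set {set 'I_n}}) (t : nat) : nat :=
  #|[set F : {set {set 'I_n}} | [&& F \subset G, #|F| == t & intersecting F]]|.

Definition symdiff (n : nat) (A B : {set 'I_n}) : {set 'I_n} :=
  (A :\: B) :|: (B :\: A).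

Definition is_min (n : nat) (S : {set 'I_n}) (i : 'I_n) : bool :=
  (i \in S) && [forall j in S, i <= j].

Definition lex_lt (n : nat) (A B : {set 'I_n}) : bool :=
  [exists i, is_min (symdiff A B) i && (i \in A)].

Definition lex_le (n : nat) (A B : {set 'I_n}) : bool :=
  (A == B) || lex_lt A B.

Definition lex_graph (n m : nat) : {set {set 'I_n}} :=
  [set:: take m (sort (@lex_le n) (enum (pairs n)))].

(* Main.v *)
Require Import Defs.
From mathcomp Require Import all_boot all_order all_algebra.
From mathcomp Require Import reals exp zify.

(** Write [t = T + 1].  The cases [t <= 1] are trivial because every single edge
    is an intersecting family.  For [T >= 1] an intersecting family of edges is
    contained in the star of a vertex or is a triangle, so adding a new edge
    [uv] to a graph [G] creates exactly
    [C(deg u, T) + C(deg v, T) + [T = 2] * codeg(u, v)]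
    new intersecting families ([int_countU]).  The whole argument is run on
    these increments ([gain]).

    A lexicographic graph consists of [k] full stars, centred at a set [A] and
    forming the graph [stars A], plus a partial star with [r] edges; its value
    is [lex_value n T k r].  Two situations are settled by comparing increments
    one edge at a time.  If [G] has [k] vertices of full degree, the [j]-th
    further edge gains at most as much as the [j]-th edge of the partial star,
    by convexity of binomials ([int_count_le_full]).  If [G] has a vertex cover
    with [k + 1] vertices, then [G] and the lexicographic graph both arise from
    [k + 1] full stars by deleting edges, and deleting all of them at the same
    centre is cheapest ([int_count_le_cover]).

    It remains to see that a maximiser [G] is in one of these situations.
    Suppose it has [i < k] full vertices.  Comparing averages with a graph
    having [k] full stars shows that the largest degree [D] among the other
    vertices is a definite proportion of [n] ([star_average_bound],
    [degree_lower_bound]).  The centre [w] of degree [D] is not full, so an edge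
    can be moved to it; maximality makes every edge of [G] have an endpoint in
    the set [B] of vertices [v] with [2 C(deg v, T) >= C(D, T)] ([swap_edge]).
    Thus [B] is a vertex cover by vertices of large degree, and counting edges
    bounds its size ([cover_small]).  If [B] had more than [k + 1] vertices,
    moving all private edges of its vertex of least degree to the rest of [B]
    would be a strict gain ([shift_edges]); hence [B] has at most [k + 1]
    vertices and the second situation applies ([optimal_le_lex_value]).

    The hypothesis on [n] enters only in the form
    [64 * (4 l) ^ T <= n ^ T] ([nat_hypothesis]). *)

Set Implicit Arguments.
Unset Strict Implicit.
Unset Printing Implicit Defensive.

(** * Increments of the number of intersecting families *)

Definition nbhd n (G : {set {set 'I_n}}) (v : 'I_n) : {set 'I_n} :=
  [set x | [set v; x] \in G].

Definition deg n (G : {set {set 'I_n}}) (v : 'I_n) : nat := #|nbhd G v|.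

(** The increment of the number of intersecting [(T + 1)]-families when the
    edge [uv] is added to [G]: families inside the star of [u], inside the star
    of [v], and triangles through [uv], which have three edges, whence [T = 2]. *)
Definition gain n (G : {set {set 'I_n}}) (T : nat) (u v : 'I_n) : nat :=
  'C(deg G u, T) + 'C(deg G v, T) + (T == 2) * #|nbhd G u :&: nbhd G v|.

Lemma pairE n (e : {set 'I_n}) (u : 'I_n) :
  e \in pairs n -> u \in e -> exists2 x, x != u & e = [set u; x].
Proof.
rewrite inE => /cards2P [a [b [ab ->]]]; rewrite !inE => /orP[/eqP->|/eqP->].
  by exists b; rewrite // eq_sym.
by exists a; rewrite // setUC.
Qed.

Lemma pair_in_pairs n (u v : 'I_n) : ([set u; v] \in pairs n) = (u != v).
Proof. by rewrite inE cards2; case: (u != v). Qed.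

Lemma nbhd_neq n (G : {set {set 'I_n}}) u x :
  G \subset pairs n -> x \in nbhd G u -> u != x.
Proof. by move=> /subsetP sG; rewrite inE => /sG; rewrite pair_in_pairs. Qed.

Lemma star_imset n (G : {set {set 'I_n}}) u : G \subset pairs n ->
  [set e in G | u \in e] = [set [set u; x] | x in nbhd G u].
Proof.
move=> /subsetP sG; apply/setP => e; apply/idP/imsetP => [|[x]].
  rewrite inE => /andP[eG ue]; have [x _ ex] := pairE (sG _ eG) ue.
  by exists x; rewrite // inE -ex.
by rewrite !inE => xG ->; rewrite xG !inE eqxx.
Qed.

Lemma pair_injl n (u x y : 'I_n) : u != x -> [set u; x] = [set u; y] -> x = y.
Proof.
move=> ux /setP/(_ x); rewrite !inE eqxx orbT [x == u]eq_sym (negbTE ux) /=.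
by move=> /esym/eqP.
Qed.

Lemma card_star n (G : {set {set 'I_n}}) u : G \subset pairs n ->
  #|[set e in G | u \in e]| = deg G u.
Proof.
move=> sG; rewrite star_imset // card_in_imset // => x y xN _.
by apply: pair_injl; apply: nbhd_neq xN.
Qed.

Lemma intersectingP n (F : {set {set 'I_n}}) :
  reflect (forall A B, A \in F -> B \in F -> exists2 x, x \in A & x \in B)
          (intersecting F).
Proof.
apply: (iffP forall_inP) => [h A B AF BF|h A AF].
  have /forall_inP/(_ B BF) := h A AF.
  by case/set0Pn=> x; rewrite inE => /andP[xA xB]; exists x.
apply/forall_inP => B BF; have [x xA xB] := h A B AF BF.
by apply/set0Pn; exists x; rewrite inE xA.
Qed.

(** If some edge of the family misses [u] and another one misses [v], these two
    meet [uv] in different endpoints, so they close up to a triangle with [uv];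
    no further edge meets all three sides of a triangle. *)
Lemma intersecting_link n (G F : {set {set 'I_n}}) (u v : 'I_n) :
  G \subset pairs n -> u != v -> [set u; v] \notin G -> F \subset G ->
  intersecting ([set u; v] |: F) ->
  [\/ F \subset [set e in G | u \in e], F \subset [set e in G | v \in e]
    | exists2 x, x \in nbhd G u :&: nbhd G v & F = [set [set u; x]; [set v; x]]].
Proof.
move=> sG uv eG FG /intersectingP iF.
have FP c : c \in F -> c \in pairs n.
  by move=> cF; apply: (subsetP sG); apply: (subsetP FG).
have Fe c : c \in F -> c != [set u; v].
  by move=> cF; apply: contraNneq eG => <-; apply: (subsetP FG).
have meet c : c \in F -> (u \in c) || (v \in c).
  move=> cF; have [|x] := iF [set u; v] c _ (setU1r _ cF); first exact: setU11.
  by rewrite !inE => /orP[/eqP->|/eqP->] ->; rewrite ?orbT.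
case: (boolP [forall c in F, u \in c]) => [/forall_inP hu|].
  apply: Or31; apply/subsetP => c cF.
  by rewrite inE (subsetP FG) //= hu.
case: (boolP [forall c in F, v \in c]) => [/forall_inP hv _|].
  apply: Or32; apply/subsetP => c cF.
  by rewrite inE (subsetP FG) //= hv.
rewrite !negb_forall_in => /exists_inP[b bF vb] /exists_inP[a aF ua].
have va : v \in a by have := meet a aF; rewrite (negbTE ua).
have ub : u \in b by have := meet b bF; rewrite (negbTE vb) orbF.
have [x xv ax] := pairE (FP a aF) va.
have [y yu bY] := pairE (FP b bF) ub.
have xu : x != u by apply: contraNneq ua => <-; rewrite ax !inE eqxx orbT.
have yv : y != v by apply: contraNneq vb => <-; rewrite bY !inE eqxx orbT.
have yx : y = x.
  have [z] := iF a b (setU1r _ aF) (setU1r _ bF).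
  rewrite ax bY !inE => /orP[]/eqP-> /orP[]/eqP E.
  - by rewrite E eqxx in uv.
  - by rewrite E eqxx in yv.
  - by rewrite E eqxx in xu.
  by [].
subst y; apply: Or33; exists x.
  by rewrite !inE -ax -bY !(subsetP FG).
apply/eqP; rewrite eqEsubset; apply/andP; split; last first.
  by apply/subsetP => c; rewrite !inE -ax -bY => /orP[]/eqP->.
apply/subsetP => c cF; rewrite !inE -ax -bY.
case/orP: (meet c cF) => hc; have [z zu cz] := pairE (FP c cF) hc.
  have [s] := iF c a (setU1r _ cF) (setU1r _ aF).
  rewrite ax cz !inE => /orP[]/eqP-> /orP[]/eqP E.
  - by rewrite E eqxx in uv.
  - by rewrite E eqxx in xu.
  - by have := Fe c cF; rewrite cz E eqxx.
  by rewrite bY E eqxx.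
have [s] := iF c b (setU1r _ cF) (setU1r _ bF).
rewrite bY cz !inE => /orP[]/eqP-> /orP[]/eqP E.
- by rewrite E eqxx in uv.
- by rewrite E eqxx in xv.
- by have := Fe c cF; rewrite cz E setUC eqxx.
by rewrite ax E eqxx orbT.
Qed.

(** Removing [e] turns the families that contain [e] into the families counted
    by the last term, called links of [e] below. *)
Lemma int_count_link n (G : {set {set 'I_n}}) (T : nat) (e : {set 'I_n}) :
  e \notin G ->
  int_count (e |: G) T.+1 = int_count G T.+1 +
    #|[set F : {set {set 'I_n}} |
        [&& F \subset G, #|F| == T & intersecting (e |: F)]]|.
Proof.
move=> eG; rewrite /int_count.
rewrite -(cardsID [set F : {set {set 'I_n}} | e \in F]) addnC; congr (_ + _).
  congr #|pred_of_set _|; apply/setP => F; rewrite !inE.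
  case: (boolP (e \in F)) => [eF|eF] /=.
    by symmetry; apply/negbTE/negP => /andP[/subsetP/(_ e eF)]; rewrite (negbTE eG).
  suff -> : (F \subset e |: G) = (F \subset G) by [].
  apply/idP/idP => [/subsetP sF|sF]; last exact: subset_trans (subsetUr _ _).
  apply/subsetP => c cF; have := sF c cF; rewrite !inE => /orP[/eqP ce|//].
  by rewrite -ce cF in eF.
rewrite -[RHS](@card_in_imset _ _ (fun F => e |: F)); last first.
  move=> F1 F2; rewrite !inE => /and3P[F1G _ _] /and3P[F2G _ _] /= E.
  have nF (F : {set {set 'I_n}}) : F \subset G -> e \notin F.
    by move=> /subsetP h; apply: contra eG => /h.
  by have := setU1K (nF _ F1G); rewrite [e |: F1]E setU1K ?nF.
congr #|pred_of_set _|; apply/setP => F; apply/idP/imsetP.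
  rewrite !inE => /andP[/and3P[FG /eqP cF iF] eF].
  exists (F :\ e); last by rewrite setD1K.
  rewrite inE setD1K // iF andbT; apply/andP; split.
    by rewrite subDset.
  by move: cF; rewrite (cardsD1 e) eF add1n => -[->].
case=> F'; rewrite inE => /and3P[FG /eqP cF iF] ->.
rewrite !inE eqxx iF setUS //= cardsU1 cF.
by rewrite (contra (subsetP FG e)) // !andbT.
Qed.

(** The three kinds of links are disjoint: an edge of [G] cannot contain both
    [u] and [v], and the two sides of a triangle each miss one of them. *)
Lemma card_links n (G : {set {set 'I_n}}) (T : nat) (u v : 'I_n) :
  G \subset pairs n -> u != v -> [set u; v] \notin G -> 0 < T ->
  #|[set F : {set {set 'I_n}} |
      [&& F \subset G, #|F| == T & intersecting ([set u; v] |: F)]]|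
    = gain G T u v.
Proof.
move=> sG uv eG T0; set e := [set u; v].
pose star w := [set a in G | w \in a].
pose Pst w := [set F : {set {set 'I_n}} | F \subset star w & #|F| == T].
pose tr x : {set {set 'I_n}} := [set [set u; x]; [set v; x]].
pose Ptr := if T == 2 then tr @: (nbhd G u :&: nbhd G v) else set0.
have starG w (F : {set {set 'I_n}}) : F \subset star w -> F \subset G.
  by move=> h; apply: subset_trans h _; apply/subsetP => c; rewrite inE => /andP[].
have starw w (F : {set {set 'I_n}}) c : F \subset star w -> c \in F -> w \in c.
  by move=> /subsetP h /h; rewrite inE => /andP[].
have tr_neq x : u != x -> [set u; x] != [set v; x].
  move=> ux; apply/eqP; rewrite setUC [[set v; x]]setUC => /pair_injl.
  by rewrite eq_sym => /(_ ux) E; rewrite E eqxx in uv.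
have trP F : F \in Ptr -> [/\ T = 2 & exists x,
    [/\ u != x, v != x, x \in nbhd G u :&: nbhd G v & F = tr x]].
  rewrite /Ptr; case: eqP => [->|_]; last by rewrite inE.
  case/imsetP => y yN ->; split=> //; exists y.
  by case/setIP: (yN) => /(nbhd_neq sG) ? /(nbhd_neq sG) ?; split.
have cst w : #|Pst w| = 'C(deg G w, T) by rewrite cards_draws card_star.
have ctr : #|Ptr| = (T == 2) * #|nbhd G u :&: nbhd G v|.
  rewrite /Ptr; case: eqP => _; last by rewrite cards0.
  rewrite mul1n card_in_imset // => x y /setIP[/(nbhd_neq sG) ux _] /setIP[/(nbhd_neq sG) uy _].
  move=> /setP/(_ [set u; x]).
  rewrite !inE eqxx /= => /esym/orP[]/eqP; first exact: pair_injl.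
  by move/setP/(_ u); rewrite !inE eqxx (negbTE uv) (negbTE uy).
have eq1 : [set F : {set {set 'I_n}} |
      [&& F \subset G, #|F| == T & intersecting (e |: F)]]
    = (Pst u :|: Pst v) :|: Ptr.
  apply/setP => F; rewrite !inE; apply/idP/idP.
    case/and3P=> FG cF iF; rewrite cF !andbT.
    case: (intersecting_link sG uv eG FG iF) => [->|->|[x xN Fx]]; rewrite ?orbT //.
    apply/orP; right; move: cF; rewrite Fx cards2 tr_neq /=; last first.
      by move: xN; rewrite inE => /andP[/(nbhd_neq sG)].
    by rewrite /Ptr eq_sym => ->; apply: imset_f.
  have ist w : w \in e -> F \subset star w -> intersecting (e |: F).
    move=> we sF; apply/intersectingP => A B.
    have hw C : C \in e |: F -> w \in C.
      by rewrite !inE => /orP[/eqP->//|]; apply: starw.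
    by move=> /hw ? /hw ?; exists w.
  case/orP=> [/orP[/andP[sF ->]|/andP[sF ->]]|/trP[T2 [x [ux vx]]]].
  - by rewrite (starG _ _ sF) (ist u) // /e !inE eqxx.
  - by rewrite (starG _ _ sF) (ist v) // /e !inE eqxx orbT.
  rewrite !inE => /andP[xu xv] ->.
  rewrite cards2 tr_neq // T2 eqxx /=; apply/andP; split.
    by apply/subsetP => c; rewrite !inE => /orP[]/eqP->.
  apply/intersectingP => A B; rewrite !inE.
  move=> /or3P[]/eqP-> /or3P[]/eqP->;
    (exists u; by rewrite !inE eqxx ?orbT) || (exists v; by rewrite !inE eqxx ?orbT)
    || (exists x; by rewrite !inE eqxx ?orbT).
rewrite eq1 cardsU (_ : (_ :|: _) :&: Ptr = set0); last first.
  apply/setP => F; rewrite in_set0; apply/negbTE/negP.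
  rewrite in_setI => /andP[FP /trP[_ [x [ux vx _ Fx]]]]; move: FP; rewrite Fx !inE.
  case/orP=> /andP[sF _].
    have := starw _ _ [set v; x] sF; rewrite !inE eqxx orbT (negbTE uv) (negbTE ux).
    by move/(_ isT).
  have := starw _ _ [set u; x] sF; rewrite !inE eqxx (eq_sym v u) (negbTE uv).
  by rewrite (negbTE vx) => /(_ isT).
rewrite cards0 subn0 ctr cardsU (_ : _ :&: _ = set0) ?cards0 ?subn0 ?cst //.
apply/setP => F; rewrite in_set0; apply/negbTE/negP.
rewrite !inE => /andP[/andP[sFu cF] /andP[sFv _]].
have : 0 < #|F| by rewrite (eqP cF).
case/card_gt0P=> c cF'; have uc := starw _ _ _ sFu cF'; have vc := starw _ _ _ sFv cF'.
have cG : c \in G by apply: (subsetP (starG _ _ sFu)).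
have [x _ cx] := pairE (subsetP sG _ cG) uc.
move: vc eG; rewrite cx !inE eq_sym (negbTE uv) => /eqP->.
by rewrite -cx cG.
Qed.

Lemma int_countU n (G : {set {set 'I_n}}) (T : nat) (u v : 'I_n) :
  G \subset pairs n -> u != v -> [set u; v] \notin G -> 0 < T ->
  int_count ([set u; v] |: G) T.+1 = int_count G T.+1 + gain G T u v.
Proof. by move=> sG uv eG T0; rewrite int_count_link // card_links. Qed.

(** * Degrees and unions of stars *)

Definition stars n (A : {set 'I_n}) : {set {set 'I_n}} :=
  [set e in pairs n | A :&: e != set0].

Lemma nbhdU_in n (G : {set {set 'I_n}}) u v :
  nbhd ([set u; v] |: G) u = v |: nbhd G u.
Proof.
apply/setP => x; rewrite !inE; congr (_ || _); apply/eqP/eqP => [E|-> //].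
have /setP E1 := E; have := E1 x; have := E1 v; rewrite !inE !eqxx !orbT /=.
by case: (eqVneq v u) => [-> _|vu /eqP//]; rewrite orbb => /esym/eqP.
Qed.

Lemma nbhdU_out n (G : {set {set 'I_n}}) u v w : w \notin [set u; v] ->
  nbhd ([set u; v] |: G) w = nbhd G w.
Proof.
move=> we; apply/setP => x; rewrite !inE.
by case: eqP => // E; rewrite -E !inE eqxx in we.
Qed.

Lemma degU_in n (G : {set {set 'I_n}}) u v : [set u; v] \notin G ->
  deg ([set u; v] |: G) u = (deg G u).+1.
Proof. by move=> uv; rewrite /deg nbhdU_in cardsU1 inE uv. Qed.

Lemma degU_inr n (G : {set {set 'I_n}}) u v : [set u; v] \notin G ->
  deg ([set u; v] |: G) v = (deg G v).+1.
Proof. by rewrite setUC => /degU_in. Qed.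

Lemma degU_out n (G : {set {set 'I_n}}) u v w : w \notin [set u; v] ->
  deg ([set u; v] |: G) w = deg G w.
Proof. by move=> we; rewrite /deg nbhdU_out. Qed.

(** Every supergraph of [S] is built from [S] by adding edges one at a time, so
    bounds on increments integrate to bounds on [int_count]. *)
Lemma graph_ind n (P : {set {set 'I_n}} -> Prop) (S : {set {set 'I_n}}) :
  P S ->
  (forall (G : {set {set 'I_n}}) u v, S \subset G -> G \subset pairs n -> u != v ->
     [set u; v] \notin G -> P G -> P ([set u; v] |: G)) ->
  forall G : {set {set 'I_n}}, S \subset G -> G \subset pairs n -> P G.
Proof.
move=> PS IH G; move En: #|G :\: S| => N; elim: N G En => [|N IHN] G En SG sG.
  suff -> : G = S by [].
  by apply/eqP; rewrite eqEsubset SG andbT -setD_eq0 -cards_eq0 En.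
have : 0 < #|G :\: S| by rewrite En.
case/card_gt0P=> e; rewrite inE => /andP[eS eG].
have := subsetP sG _ eG; rewrite inE => /cards2P[u [v [uv eE]]].
rewrite -(setD1K eG) eE; apply: IH => //.
- by rewrite -eE subsetD1 SG.
- by apply: subset_trans sG; apply: subD1set.
- by rewrite -eE !inE eqxx.
rewrite -eE; apply: IHN; last 2 first.
- by rewrite subsetD1 SG.
- by apply: subset_trans sG; apply: subD1set.
move: En; rewrite (cardsD1 e) !inE eS eG add1n => -[<-]; congr #|pred_of_set _|.
by apply/setP => x; rewrite !inE; case: (x == e); rewrite ?andbF.
Qed.

Lemma sum_deg_in n (G : {set {set 'I_n}}) (B : {set 'I_n}) : G \subset pairs n ->
  \sum_(v in B) deg G v = \sum_(e in G) #|B :&: e|.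
Proof.
move=> sG; under eq_bigr do rewrite -card_star //.
transitivity (\sum_(v in B) \sum_(e in G) (v \in e : nat)).
  apply: eq_bigr => v _; rewrite -sum1_card big_mkcond [RHS]big_mkcond /=.
  by apply: eq_bigr => e _; rewrite inE; case: (e \in G); case: (v \in e).
rewrite exchange_big /=; apply: eq_bigr => e _.
rewrite -sum1_card big_mkcond [RHS]big_mkcond /=.
by apply: eq_bigr => v _; rewrite inE; case: (v \in B); case: (v \in e).
Qed.

Lemma sum_deg n (G : {set {set 'I_n}}) : G \subset pairs n ->
  \sum_v deg G v = 2 * #|G|.
Proof.
move=> sG; transitivity (\sum_(v in [set: 'I_n]) deg G v).
  by apply: eq_bigl => v; rewrite inE.
rewrite sum_deg_in // mulnC -sum_nat_const; apply: eq_bigr => e /(subsetP sG).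
by rewrite setTI inE => /eqP.
Qed.

(** The sum counts an edge twice only when both its ends lie in [B], and [B]
    spans at most [C(#|B|, 2)] edges. *)
Lemma sum_deg_in_le n (G : {set {set 'I_n}}) (B : {set 'I_n}) :
  G \subset pairs n -> \sum_(v in B) deg G v <= #|G| + 'C(#|B|, 2).
Proof.
move=> sG; rewrite sum_deg_in //.
pose H := [set e : {set 'I_n} | e \subset B & #|e| == 2].
apply: (@leq_trans (\sum_(e in G) (1 + (e \in H)))).
  apply: leq_sum => e /(subsetP sG); rewrite inE => /eqP e2.
  rewrite inE e2 eqxx andbT; case: (boolP (e \subset B)) => eB.
    have -> : 1 + true = #|e| by rewrite e2.
    by rewrite subset_leq_card // subsetIr.
  rewrite addn0; have : #|B :&: e| < #|e|; last by rewrite e2.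
  rewrite proper_card // properE subsetIr /=.
  by apply: contra eB => h; apply: subset_trans h (subsetIl _ _).
rewrite big_split /= sum1_card leq_add2l -cards_draws -sum1_card.
rewrite big_mkcond [X in _ <= X]big_mkcond /=; apply: leq_sum => e _.
by case: (e \in G); case: (e \in _).
Qed.

Lemma degD n (S G : {set {set 'I_n}}) u : S \subset G ->
  deg G u = deg S u + deg (G :\: S) u.
Proof.
move=> SG; rewrite /deg -(cardsID (nbhd S u) (nbhd G u)); congr (_ + _).
  rewrite (setIidPr _) //; apply/subsetP => x; rewrite !inE; exact: (subsetP SG).
by congr #|pred_of_set _|; apply/setP => x; rewrite !inE.
Qed.

(** The stars of [u] and [v] can only share the edge [uv]. *)
Lemma deg_add_le n (G : {set {set 'I_n}}) u v : G \subset pairs n -> u != v ->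
  deg G u + deg G v <= #|G| + ([set u; v] \in G).
Proof.
move=> sG uv; rewrite -!card_star // -cardsUI leq_add //.
  by apply/subset_leq_card/subsetP => e; rewrite !inE => /orP[]/andP[].
have sub : [set e in G | u \in e] :&: [set e in G | v \in e] \subset [set [set u; v]].
  apply/subsetP => e; rewrite !inE => /andP[/andP[eG ue] /andP[_ ve]].
  have [x xu eE] := pairE (subsetP sG _ eG) ue.
  by move: ve; rewrite eE !inE [v == u]eq_sym (negbTE uv) => /eqP->.
case: (boolP (_ \in G)) => uvG.
  by apply: leq_trans (subset_leq_card sub) _; rewrite cards1.
rewrite leqn0 cards_eq0; apply/eqP/setP => e; rewrite in_set0.
apply/negbTE/negP => eI; have := subsetP sub _ eI.
by move: eI; rewrite !inE => /andP[/andP[eG _] _] /eqP eE; rewrite -eE eG in uvG.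
Qed.

Lemma pair_in_stars n (A : {set 'I_n}) u v :
  ([set u; v] \in stars A) = (u != v) && ((u \in A) || (v \in A)).
Proof.
rewrite inE pair_in_pairs; congr (_ && _); apply/set0Pn/orP.
  by case=> x; rewrite !inE => /andP[xA /orP[]/eqP<-]; [left|right].
by case=> h; [exists u|exists v]; rewrite !inE h eqxx ?orbT.
Qed.

Lemma stars_sub n (A : {set 'I_n}) : stars A \subset pairs n.
Proof. by apply/subsetP => e; rewrite inE => /andP[]. Qed.

Lemma starsS n (A B : {set 'I_n}) : A \subset B -> stars A \subset stars B.
Proof.
move=> AB; apply/subsetP => e; rewrite !inE => /andP[-> /set0Pn[x]].
rewrite inE => /andP[xA xe]; apply/set0Pn; exists x.
by rewrite inE xe (subsetP AB).
Qed.

Lemma nbhd_stars n (A : {set 'I_n}) u :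
  nbhd (stars A) u = if u \in A then [set~ u] else A.
Proof.
apply/setP => x; rewrite inE pair_in_stars; case: ifP => uA /=.
  by rewrite andbT !inE eq_sym.
by case: eqP => // <-; rewrite uA.
Qed.

Lemma card_pairs n : #|pairs n| = 'C(n, 2).
Proof.
rewrite -[n in RHS]card_ord -cardsT -cards_draws; congr #|pred_of_set _|.
by apply/setP => e; rewrite !inE subsetT.
Qed.

Lemma card_stars n (A : {set 'I_n}) : #|stars A| = 'C(n, 2) - 'C(n - #|A|, 2).
Proof.
rewrite -card_pairs -(cardsID (stars A) (pairs n)).
rewrite (setIidPr (stars_sub A)).
suff -> : #|pairs n :\: stars A| = 'C(n - #|A|, 2) by rewrite addnK.
have -> : n - #|A| = #|~: A| by rewrite [RHS]cardsCs setCK card_ord.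
rewrite -cards_draws; congr #|pred_of_set _|; apply/setP => e; rewrite !inE.
rewrite -disjoints_subset -setI_eq0 [e :&: A]setIC.
by case: (#|e| == 2); case: (A :&: e == set0).
Qed.

(** The gain of the edge from a new centre [a] to its [j]-th neighbour, above
    [k] full stars: [a] has degree [k + j], the neighbour has degree [k], and
    their common neighbours are the [k] old centres. *)
Definition star_gain T k j := 'C(k + j, T) + 'C(k, T) + (T == 2) * k.

Definition stars_count n T k :=
  \sum_(h < k) \sum_(j < n - 1 - h) star_gain T h j.

Definition fan n (a : 'I_n) (X : {set 'I_n}) : {set {set 'I_n}} :=
  [set [set a; x] | x in X].

Lemma nbhd_fan n (a : 'I_n) (A X : {set 'I_n}) : a \notin A -> a \notin X ->
  nbhd (stars A :|: fan a X) a = A :|: X.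
Proof.
move=> aA aX; apply/setP => x; rewrite in_setU.
have -> : (x \in nbhd (stars A :|: fan a X) a) =
  (x \in nbhd (stars A) a) || ([set a; x] \in fan a X) by rewrite !inE.
rewrite nbhd_stars (negbTE aA); congr (_ || _).
apply/imsetP/idP => [[y yX /setP/(_ y)]|xX]; last by exists x.
rewrite !inE eqxx orbT; case: (eqVneq y a) => [ya|_ /eqP<- //].
by rewrite -ya yX in aX.
Qed.

Lemma fanU1 n (a x : 'I_n) (X : {set 'I_n}) :
  fan a (x |: X) = [set a; x] |: fan a X.
Proof. by rewrite /fan imsetU1. Qed.

Lemma nbhd_fan_out n (a x : 'I_n) (A X : {set 'I_n}) :
  x \notin A -> x != a -> x \notin X -> nbhd (stars A :|: fan a X) x = A.
Proof.
move=> xA xa xX; apply/setP => y.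
have -> : (y \in nbhd (stars A :|: fan a X) x) =
  (y \in nbhd (stars A) x) || ([set x; y] \in fan a X) by rewrite !inE.
rewrite nbhd_stars (negbTE xA); case: (y \in A) => //=.
apply/imsetP => -[z zX /setP/(_ x)]; rewrite !inE eqxx (negbTE xa) /=.
by move/esym/eqP=> xz; rewrite xz zX in xX.
Qed.

Lemma fan_sub n (a : 'I_n) (X : {set 'I_n}) : a \notin X -> fan a X \subset pairs n.
Proof.
move=> aX; apply/subsetP => e /imsetP[x xX ->]; rewrite pair_in_pairs.
by apply: contraNneq aX => ->.
Qed.

Lemma stars_fan_sub n (a : 'I_n) (A X : {set 'I_n}) : a \notin X ->
  stars A :|: fan a X \subset pairs n.
Proof. by move=> aX; rewrite subUset stars_sub fan_sub. Qed.

Lemma stars_fan_disj n (a x : 'I_n) (A X : {set 'I_n}) :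
  a \notin A -> a \notin X -> x \notin A -> x \notin X ->
  [set a; x] \notin stars A :|: fan a X.
Proof.
move=> aA aX xA xX.
have -> : ([set a; x] \in stars A :|: fan a X) =
  (x \in nbhd (stars A :|: fan a X) a) by rewrite [in RHS]inE.
by rewrite nbhd_fan // inE negb_or xA.
Qed.

Lemma int_count_fan n T (A X : {set 'I_n}) (a : 'I_n) : 0 < T ->
  a \notin A -> a \notin X -> [disjoint X & A] ->
  int_count (stars A :|: fan a X) T.+1 =
    int_count (stars A) T.+1 + \sum_(j < #|X|) star_gain T #|A| j.
Proof.
move=> T0 aA; move Er: #|X| => r; elim: r X Er => [|r IH] X Er aX XA.
  by rewrite (cards0_eq Er) /fan imset0 setU0 big_ord0 addn0.
have : 0 < #|X| by rewrite Er.
case/card_gt0P=> x xX; set X' := X :\ x.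
have xA : x \notin A by rewrite (disjointFr XA).
have ax : a != x by apply: contraNneq aX => ->.
have aX' : a \notin X' by rewrite !inE (negbTE aX) andbF.
have xX' : x \notin X' by rewrite !inE eqxx.
have cX' : #|X'| = r by move: Er; rewrite (cardsD1 x) xX add1n => -[].
have X'A : [disjoint X' & A].
  by apply: disjointWl XA; apply: subD1set.
rewrite -(setD1K xX) -/X' fanU1 setUCA int_countU //; last 2 first.
- exact: stars_fan_sub.
- exact: stars_fan_disj.
rewrite IH // big_ord_recr /= -addnA; congr (_ + (_ + _)).
rewrite /gain /star_gain /deg nbhd_fan // nbhd_fan_out // 1?eq_sym //.
rewrite cardsU (_ : A :&: X' = set0) ?cards0 ?subn0 ?cX'; last first.
  by apply/eqP; rewrite setIC setI_eq0.
by rewrite (setIidPr _) // subsetUl.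
Qed.

Lemma pair_in_fan n (a u v : 'I_n) (X : {set 'I_n}) : a \notin X ->
  ([set u; v] \in fan a X) = (u == a) && (v \in X) || (v == a) && (u \in X).
Proof.
move=> aX; apply/imsetP/orP => [[x xX E]|[]/andP[/eqP-> h]]; last 2 first.
- by exists v.
- by exists u; rewrite // setUC.
have xa : x != a by apply: contraNneq aX => <-.
have /setP/(_ x) := E; have /setP/(_ a) := E; rewrite !inE !eqxx orbT /=.
case/orP=> /eqP aE /orP[]/eqP xE.
- by rewrite xE aE eqxx in xa.
- by left; rewrite aE eqxx -xE.
- by right; rewrite aE eqxx -xE.
by rewrite xE aE eqxx in xa.
Qed.

Lemma starsU1 n (A : {set 'I_n}) (a : 'I_n) :
  stars (a |: A) = stars A :|: fan a (~: (a |: A)).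
Proof.
have aX : a \notin ~: (a |: A) by rewrite !inE eqxx.
apply/setP => e; case: (boolP (e \in pairs n)) => ep; last first.
  rewrite (contraNF (subsetP (stars_sub _) e) ep).
  by rewrite (contraNF (subsetP (stars_fan_sub _ aX) e) ep).
move: (ep); rewrite inE => /cards2P[u [v [uv ->]]].
rewrite in_setU !pair_in_stars pair_in_fan // !inE uv /=.
move: uv; case: (eqVneq u a) => [->|ua]; case: (eqVneq v a) => [->|va] //=.
- by case: (a \in A); case: (v \in A).
- by case: (a \in A); case: (u \in A).
by rewrite orbF.
Qed.

Lemma int_count0 n T : int_count (set0 : {set {set 'I_n}}) T.+1 = 0.
Proof.
apply/eqP; rewrite cards_eq0; apply/eqP/setP => F; rewrite !inE subset0.
by case: eqP => //= ->; rewrite cards0.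
Qed.

(** Full stars are added one at a time; the star of the [h]-th centre has
    [n - 1 - h] edges that were not there before. *)
Lemma int_count_stars n T (A : {set 'I_n}) : 0 < T ->
  int_count (stars A) T.+1 = stars_count n T #|A|.
Proof.
move=> T0; move Ek: #|A| => k; elim: k A Ek => [|k IH] A Ek.
  rewrite (cards0_eq Ek) /stars_count big_ord0 -(int_count0 n T).
  by congr int_count; apply/setP => e; rewrite !inE set0I eqxx andbF.
have : 0 < #|A| by rewrite Ek.
case/card_gt0P=> a aA; rewrite -(setD1K aA) starsU1.
have cA : #|A :\ a| = k by move: Ek; rewrite (cardsD1 a) aA add1n => -[].
rewrite int_count_fan //; first 1 last.
- by rewrite !inE eqxx.
- by rewrite !inE eqxx.
- by rewrite disjoint_sym disjoints_subset setCK subsetUr.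
rewrite IH // /stars_count big_ord_recr /= cA; congr (_ + _).
have -> : #|~: (a |: A :\ a)| = n - 1 - k; last by [].
by rewrite cardsCs setCK card_ord setD1K // Ek -subnDA add1n.
Qed.

(** The number of intersecting [(T + 1)]-families of the lexicographic graph
    with [k] full stars and a partial star of [r] edges. *)
Definition lex_value n T k r :=
  stars_count n T k + \sum_(j < r) star_gain T k j.

(** * The two edge-by-edge comparisons *)

Lemma bin_convex T x y a : x <= y ->
  'C(x + a, T) + 'C(y, T) <= 'C(y + a, T) + 'C(x, T).
Proof.
move=> xy; case: T => [|T]; first by rewrite !bin0.
elim: a => [|a IH]; first by rewrite !addn0 addnC.
rewrite !addnS !binS.
have : 'C(x + a, T) <= 'C(y + a, T) by apply: leq_bin2l; rewrite leq_add2r.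
lia.
Qed.

Lemma bin2D x a : 'C(x + a, 2) = 'C(x, 2) + x * a + 'C(a, 2).
Proof.
elim: a => [|a IH]; first by rewrite addn0 muln0 bin0n !addn0.
rewrite addnS !binS !bin1 IH; lia.
Qed.

Lemma pair_notin_stars n (G : {set {set 'I_n}}) (A : {set 'I_n}) u v :
  stars A \subset G -> u != v -> [set u; v] \notin G ->
  (u \notin A) && (v \notin A).
Proof.
move=> AG uv; rewrite -negb_or; apply: contra => h; apply: (subsetP AG).
by rewrite pair_in_stars uv.
Qed.

Lemma codeg_le n (G : {set {set 'I_n}}) u v :
  #|nbhd G u :&: nbhd G v| <= minn (deg G u) (deg G v).
Proof. by rewrite leq_min !subset_leq_card // ?subsetIl ?subsetIr. Qed.

Lemma deg_stars n (A : {set 'I_n}) u :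
  deg (stars A) u = if u \in A then n - 1 else #|A|.
Proof.
rewrite /deg nbhd_stars; case: ifP => // _.
by rewrite cardsC1 card_ord subn1.
Qed.

Lemma cardsD_sub (U : finType) (S G : {set U}) : S \subset G ->
  #|G| = #|S| + #|G :\: S|.
Proof. by move=> SG; rewrite -(cardsID S G) (setIidPr SG). Qed.

(** When [j] edges lie above [stars I], the endpoints of the next one have
    degrees [k + a] and [k + b] with [a + b <= j], and by convexity the gain is
    largest for [a = j] and [b = 0].  In the triangle case the slack in the
    convexity inequality is [a * b], which pays for the at most [min a b] common
    neighbours outside [I]. *)
Lemma int_count_le_full n T (I : {set 'I_n}) (G : {set {set 'I_n}}) : 0 < T ->
  stars I \subset G -> G \subset pairs n ->
  int_count G T.+1 <= lex_value n T #|I| (#|G| - #|stars I|).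
Proof.
move=> T0; move: G; apply: graph_ind => [|G u v IG sG uv uvG IH].
  by rewrite subnn /lex_value big_ord0 addn0 int_count_stars.
have cG := cardsD_sub IG.
rewrite int_countU // cardsU1 uvG cG addnCA addKn add1n /lex_value big_ord_recr /=.
move: IH; rewrite cG addKn /lex_value => IH.
rewrite addnA; apply: leq_add IH _.
have /andP[uI vI] := pair_notin_stars IG uv uvG.
have du := degD u IG; have dv := degD v IG.
have := @deg_add_le n (G :\: stars I) u v (subset_trans (subsetDl _ _) sG) uv.
rewrite !inE (negbTE uvG) andbF addn0.
move: du dv; rewrite !deg_stars (negbTE uI) (negbTE vI).
have := codeg_le G u v; rewrite /gain /star_gain.
move: (#|I|) (#|_ :\: _|) (deg (_ :\: _) u) (deg (_ :\: _) v) (#|_ :&: _|).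
move=> k s a b c /[swap] -> /[swap] -> hc hab.
have h1 : 'C(k + (a + b), T) <= 'C(k + s, T) by apply: leq_bin2l; lia.
case: eqP => [T2|_]; last first.
  have := @bin_convex T k (k + b) a (leq_addr _ _); rewrite !mul0n.
  by rewrite -addnA [b + a]addnC; lia.
subst T; rewrite !mul1n; move: h1; rewrite !bin2D.
have : c <= k + a * b; first by case: a b {hab} hc => [|a] [|b]; lia.
by nia.
Qed.

(** The increment of a missing edge [uv] with [u] in the cover and [v] outside.
    Here [pu] and [pv] count the missing edges at [u] and at [v]; moving the
    [pv - 1] other missing edges of [v] over to [u] only lowers the increment,
    because the degree of [u] exceeds that of [v]. *)
Lemma star_gain_le_cross T N k r q du dv pu pv :
  0 < r -> r + q.+1 = N - k -> du + pu = N -> pu + pv <= q.+2 -> 0 < pv ->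
  k.+1 = dv + pv -> star_gain T k r <= 'C(du, T) + 'C(dv, T) + (T == 2) * dv.
Proof.
move=> r0 rq du_N puv; case: pv puv => // a puv _ [kE].
have {kE} kE : k = dv + a by lia.
have hu : 'C(k + r + a, T) <= 'C(du, T) by apply: leq_bin2l; lia.
rewrite /star_gain; move: hu; rewrite kE; case: eqP => [->|_] hu; last first.
  have hr : dv <= dv + a + r by rewrite -addnA leq_addr.
  by have := bin_convex T a hr; rewrite !mul0n; lia.
by move: hu; rewrite !mul1n !bin2D; nia.
Qed.

(** The increment of a missing edge inside the cover: both ends have large
    degree, so the common neighbours can be ignored. *)
Lemma star_gain_le_inner T N k r q du dv pu pv : 0 < T ->
  0 < r -> r + q.+1 = N - k -> du + pu = N -> dv + pv = N -> pu + pv <= q.+2 ->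
  0 < pu -> 0 < pv -> star_gain T k r <= 'C(du, T) + 'C(dv, T).
Proof.
move=> T0 r0 rq du_N dv_N puv pu0 pv0.
have h1 : 'C(k + r, T) <= 'C(du, T) by apply: leq_bin2l; lia.
have h2 : 'C(k.+1, T) <= 'C(dv, T) by apply: leq_bin2l; lia.
suff h3 : 'C(k, T) + (T == 2) * k <= 'C(k.+1, T) by rewrite /star_gain; lia.
case: T T0 {h1 h2} => // T _; rewrite binS leq_add2l.
by case: eqP => [[->]|//]; rewrite bin1 mul1n.
Qed.

(** Adding the missing edges back, each increment is at least the corresponding
    increment of the partial star of the lexicographic graph.  Missing edges
    inside [B] are restored first: afterwards every neighbour of a vertex outside
    [B] is adjacent to the other endpoint, so all common neighbours are present. *)
Lemma int_count_le_cover n T k r (B : {set 'I_n}) (G : {set {set 'I_n}}) :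
  0 < T -> G \subset stars B -> #|B| = k.+1 -> 0 < r ->
  r + #|stars B :\: G| = n - 1 - k ->
  int_count G T.+1 <= lex_value n T k r.
Proof.
move=> T0 GB cB r0; move Eq: #|stars B :\: G| => q.
elim: q G r r0 GB Eq => [|q IH] G r r0 GB Eq rq.
  have -> : G = stars B.
    by apply/eqP; rewrite eqEsubset GB -setD_eq0 -cards_eq0 Eq.
  by rewrite int_count_stars // cB /stars_count big_ord_recr /= -rq addn0.
set M := stars B :\: G in Eq.
have sM : M \subset pairs n := subset_trans (subsetDl _ _) (stars_sub B).
have step u v : u != v -> [set u; v] \in M -> star_gain T k r <= gain G T u v ->
    int_count G T.+1 <= lex_value n T k r.
  move=> uv uvM; have := uvM; rewrite inE => /andP[uvG uvB] hg.
  have := IH ([set u; v] |: G) r.+1 isT.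
  rewrite subUset sub1set uvB GB /= => /(_ isT).
  have -> : stars B :\: ([set u; v] |: G) = M :\ [set u; v].
    by apply/setP => e; rewrite in_setD in_setU1 in_setD1 in_setD negb_or andbA.
  move: Eq; rewrite (cardsD1 [set u; v]) uvM add1n => -[->] /(_ erefl).
  rewrite addSnnS => /(_ rq); rewrite int_countU //; last exact: subset_trans (stars_sub B).
  by rewrite /lex_value big_ord_recr /= addnA => h; rewrite -(leq_add2r (gain G T u v)); apply: leq_trans h _; rewrite leq_add2l.
have degs u v : u != v -> [set u; v] \in M -> u \in B ->
    [/\ deg G u + deg M u = n - 1, deg M u + deg M v <= q.+2,
        0 < deg M u & 0 < deg M v].
  move=> uv uvM uB; split.
  - by have := degD u GB; rewrite deg_stars uB => ->.
  - by have := deg_add_le sM uv; rewrite uvM Eq addn1.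
  - by apply/card_gt0P; exists v; rewrite inE.
  - by apply/card_gt0P; exists u; rewrite inE setUC.
(* restore a missing edge inside B as long as there is one *)
case: (boolP [exists u in B, [exists v in B, (u != v) && ([set u; v] \in M)]]).
  case/exists_inP=> u uB /exists_inP[v vB /andP[uv uvM]].
  apply: (step u v) => //; have [du duv du0 dv0] := degs u v uv uvM uB.
  have vu : v != u by rewrite eq_sym.
  have vuM : [set v; u] \in M by rewrite [[set v; u]]setUC.
  have [dv _ _ _] := degs v u vu vuM vB.
  apply: leq_trans (leq_addr _ _).
  exact: (star_gain_le_inner T0 r0 rq du dv duv du0 dv0).
move=> noM; have : 0 < #|M| by rewrite Eq.
case/card_gt0P=> e eM; have := eM; rewrite inE => /andP[_].
rewrite inE => /andP[ep /set0Pn[u]]; rewrite inE => /andP[uB ue].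
have [v vu eE] := pairE ep ue; rewrite eE in eM.
have uv : u != v by rewrite eq_sym.
have inB x : x \in B -> u != x -> [set u; x] \notin M.
  move=> xB ux; apply: contra noM => uxM.
  by apply/exists_inP; exists u => //; apply/exists_inP; exists x; rewrite // ux.
have vB : v \notin B by apply: contraL eM => /inB; apply.
apply: (step u v) => //; have [du duv du0 dv0] := degs u v uv eM uB.
have := degD v GB; rewrite deg_stars (negbTE vB) cB -/M => dv.
have sub : nbhd G v \subset nbhd G u.
  apply/subsetP => x xv.
  have xB : x \in B.
    have := subsetP GB [set v; x]; rewrite pair_in_stars (negbTE vB) /=.
    by rewrite inE in xv => /(_ xv) /andP[].
  have ux : u != x.
    apply: contraTneq xv => <-; rewrite inE setUC; move: eM.
    by rewrite !inE => /andP[].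
  have := inB x xB ux; rewrite in_setD pair_in_stars uB ux andbT negbK.
  by rewrite [in X in _ -> X]inE.
rewrite /gain (setIidPr sub) -/(deg G v).
exact: (star_gain_le_cross T r0 rq du duv dv0 dv).
Qed.

(** * Averaging over stars *)

(** Twice the share of one endpoint, of degree [i + j], in the increment of an
    edge above [i] full stars.  The common neighbours beyond the [i] centres
    number at most the average of the two excess degrees [j], which
    accounts for the factor 2. *)
Definition rate T i j := 2 * 'C(i + j, T) + (T == 2) * j.

Lemma sum_bin i T D : 'C(i, T.+1) + \sum_(j < D) 'C(i + j, T) = 'C(i + D, T.+1).
Proof.
elim: D => [|D IH]; first by rewrite big_ord0 !addn0.
by rewrite big_ord_recr /= addnA IH addnS binS.
Qed.

Lemma sum_rate T i D :
  \sum_(j < D) rate T i j + 2 * 'C(i, T.+1) = 2 * 'C(i + D, T.+1) + (T == 2) * 'C(D, 2).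
Proof.
rewrite big_split /= -!big_distrr /= -sum_bin.
have -> : \sum_(j < D) j = 'C(D, 2) by rewrite -bin2_sum big_mkord.
by rewrite mulnDr addnAC; congr (_ + _); rewrite addnC.
Qed.

Lemma rate_mono T i j1 j2 : j1 <= j2 -> rate T i j1 <= rate T i j2.
Proof.
move=> j12; rewrite leq_add ?leq_mul2l ?j12 ?orbT //.
by rewrite leq_bin2l // leq_add2l.
Qed.

Lemma sum_prefix_average (f : nat -> nat) d D :
  (forall a b, a <= b -> f a <= f b) -> d <= D ->
  D * \sum_(j < d) f j <= d * \sum_(j < D) f j.
Proof.
move=> fm /subnKC <-; elim: (D - d) => [|e IH]; first by rewrite addn0.
rewrite addnS big_ord_recr /= mulSn mulnDr addnC leq_add //.
apply: leq_trans (_ : \sum_(j < d) f (d + e) <= _); last first.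
  by rewrite sum_nat_const card_ord.
apply: leq_sum => j _; apply: fm; apply: leq_trans (leq_addr _ _).
exact: ltnW.
Qed.

(** A sum over all degrees of a function [g] with increment [h] changes only at
    the two ends of an added edge. *)
Lemma sum_degU n (G : {set {set 'I_n}}) (g h : nat -> nat) u v :
  (forall d, g d.+1 = g d + h d) -> u != v -> [set u; v] \notin G ->
  \sum_w g (deg ([set u; v] |: G) w) =
    \sum_w g (deg G w) + (h (deg G u) + h (deg G v)).
Proof.
move=> gh uv uvG.
rewrite (bigD1 u) // (bigD1 v) 1?eq_sym //= [in RHS](bigD1 u) //.
rewrite [in RHS](bigD1 v) 1?eq_sym //= degU_in // degU_inr // !gh.
have -> : \sum_(w | (w != u) && (w != v)) g (deg ([set u; v] |: G) w)
        = \sum_(w | (w != u) && (w != v)) g (deg G w).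
  by apply: eq_bigr => w wuv; rewrite degU_out // !inE negb_or.
by rewrite -!addnA; congr (_ + _); rewrite addnCA; congr (_ + _); rewrite addnA addnC.
Qed.

(** The increments of the edges of [G] above [stars I], distributed over the
    endpoints: a vertex of degree [d] in [G] receives [rate] for each of the
    degrees it passes through. *)
Lemma int_count_above_stars n T (I : {set 'I_n}) (G : {set {set 'I_n}}) : 0 < T ->
  G \subset pairs n -> [disjoint stars I & G] ->
  2 * int_count (stars I :|: G) T.+1 <=
    2 * stars_count n T #|I| + 2 * ((T == 2) * #|I|) * #|G|
      + \sum_v \sum_(j < deg G v) rate T #|I| j.
Proof.
move=> T0; move: G.
suff H (G : {set {set 'I_n}}) : set0 \subset G -> G \subset pairs n ->
    [disjoint stars I & G] ->
    2 * int_count (stars I :|: G) T.+1 <=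
      2 * stars_count n T #|I| + 2 * ((T == 2) * #|I|) * #|G|
        + \sum_v \sum_(j < deg G v) rate T #|I| j.
  by move=> G; apply: H; apply: sub0set.
move: G; apply: graph_ind => [_|G u v _ sG uv uvG IH dG].
  by rewrite setU0 int_count_stars // -addnA leq_addr.
have GI : [disjoint stars I & G] by apply: disjointWr dG; apply: subsetUr.
have uvI : [set u; v] \notin stars I.
  by apply/negP => h; have := disjointFr dG h; rewrite !inE eqxx.
have /andP[uI vI] := pair_notin_stars (subxx _) uv uvI.
have uvIG : [set u; v] \notin stars I :|: G by rewrite in_setU negb_or uvI.
have sIG : stars I :|: G \subset pairs n by rewrite subUset stars_sub.
rewrite setUCA int_countU // cardsU1 uvG.
rewrite (@sum_degU _ _ (fun d => \sum_(j < d) rate T #|I| j) (rate T #|I|)) //; last first.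
  by move=> d; rewrite big_ord_recr.
have dw w : w \notin I -> deg (stars I :|: G) w = #|I| + deg G w.
  move=> wI; rewrite (degD w (subsetUl (stars I) G)) deg_stars (negbTE wI).
  rewrite setDUl setDv set0U; congr (_ + deg _ _).
  by apply/setDidPl; rewrite disjoint_sym.
have cod := codeg_le (stars I :|: G) u v.
have {}IH := IH GI.
rewrite /gain !dw // in cod *.
move: IH cod.
move: (\sum_v _) (#|_ :&: _|) (int_count _ _) (stars_count _ _ _) => S c f s.
rewrite /rate leq_min; move: #|I| #|G| (deg G u) (deg G v) => i m a b.
move: 'C(i + a, T) 'C(i + b, T) => x y; clear.
by case: (T == 2); rewrite ?mul1n ?mul0n ?muln0; lia.
Qed.

Definition stars_size n k := \sum_(h < k) (n - 1 - h).

Lemma stars_sizeE n k : k <= n -> stars_size n k = 'C(n, 2) - 'C(n - k, 2).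
Proof.
rewrite /stars_size; elim: k => [|k IH] kn; first by rewrite big_ord0 subn0 subnn.
rewrite big_ord_recr /= IH ?(ltnW kn) //.
have [p np] : exists p, n - k = p.+1 by exists (n - k).-1; rewrite prednK ?subn_gt0.
have -> : n - k.+1 = p by lia.
have -> : n - 1 - k = p by lia.
have : 'C(n - k, 2) <= 'C(n, 2) by apply: leq_bin2l; apply: leq_subr.
rewrite np binS bin1; lia.
Qed.

Lemma card_stars_size n (A : {set 'I_n}) : #|stars A| = stars_size n #|A|.
Proof.
by rewrite card_stars stars_sizeE // -[n in _ <= n]card_ord max_card.
Qed.

Lemma bin_le_mul h T : 'C(h, T.+1) <= h * 'C(h, T).
Proof.
have := mul_bin_left h T; have : (h - T) * 'C(h, T) <= h * 'C(h, T).
  by rewrite leq_mul2r leq_subr orbT.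
by move=> h1 h2; apply: leq_trans h1; rewrite -h2 leq_pmull.
Qed.

(** The centre contributes [C(n - 1, T + 1) - C(h, T + 1)], and the other ends
    of its edges make up for the second term as soon as [2 h <= n - 1]. *)
Lemma full_star_gain_ge n T h : h + h <= n - 1 ->
  'C(n - 1, T.+1) + (T == 2) * h * (n - 1 - h) <= \sum_(j < n - 1 - h) star_gain T h j.
Proof.
move=> hn; rewrite !big_split /= !sum_nat_const card_ord.
apply: leq_add; last by rewrite mulnC.
have hN : n - 1 = h + (n - 1 - h) by lia.
rewrite [in 'C(_, _)]hN -sum_bin addnC leq_add2l.
by apply: leq_trans (bin_le_mul _ _) _; rewrite leq_mul2r; lia.
Qed.

(** Above the first [i] stars, each edge forms [i] triangles with their centres
    (relevant for [T = 2]), and each further full star contributes all the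
    [(T + 1)]-subsets of its [n - 1] edges. *)
Lemma lex_value_ge n T i k r : i <= k -> k + k <= n + 1 ->
  stars_count n T i + (T == 2) * i * (stars_size n k + r - stars_size n i)
    + (k - i) * 'C(n - 1, T.+1) <= lex_value n T k r.
Proof.
move=> ik kn; rewrite /lex_value.
have hr : (T == 2) * i * r <= \sum_(j < r) star_gain T k j.
  rewrite mulnC -[r in r * _]card_ord -sum_nat_const; apply: leq_sum => j _.
  by rewrite /star_gain; apply: leq_trans (leq_addl _ _); rewrite leq_mul2l ik orbT.
suff h : stars_count n T i + (T == 2) * i * (stars_size n k - stars_size n i)
      + (k - i) * 'C(n - 1, T.+1) <= stars_count n T k /\ stars_size n i <= stars_size n k.
  case: h => h1 h2; apply: leq_trans (leq_add h1 hr).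
  have -> : stars_size n k + r - stars_size n i = stars_size n k - stars_size n i + r by lia.
  by rewrite mulnDr; lia.
move: kn; rewrite -(subnKC ik); elim: (k - i) => [|d IH] kn.
  by rewrite addn0 !subnn muln0 mul0n !addn0.
case: IH => [|h1 h2]; first by lia.
have hs : stars_size n (i + d.+1) = stars_size n (i + d) + (n - 1 - (i + d)).
  by rewrite addnS /stars_size big_ord_recr.
split; last by rewrite hs; apply: leq_trans h2 (leq_addr _ _).
have hd : i + d + (i + d) <= n - 1 by lia.
have := full_star_gain_ge T hd.
rewrite hs addnS {2}/stars_count big_ord_recr /= -/(stars_count n T (i + d)).
have := leq_addr d i; move: h1 h2; rewrite !addKn -[(i + d).+1]addnS addKn.
move: (\sum_(_ < _) _) (stars_count _ _ _) (stars_count _ _ _) => S s1 s2.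
move: (i + d) ('C(_, _)) (stars_size _ _) (stars_size _ _) => h C z1 z2; clear.
move: (n - 1 - h) => N; case: (T == 2); rewrite ?mul1n ?mul0n; nia.
Qed.

Lemma stars_sizeB n i k : i <= k ->
  stars_size n k - stars_size n i <= (k - i) * (n - 1 - i).
Proof.
move=> /subnKC <-; rewrite addKn; elim: (k - i) => [|d IH].
  by rewrite addn0 subnn.
rewrite addnS {1}/stars_size big_ord_recr /= -/(stars_size n (i + d)).
have : n - 1 - (i + d) <= n - 1 - i by apply: leq_sub2l; apply: leq_addr.
lia.
Qed.

(** The edges above [stars I] number at most twice what [k - i] full stars use,
    since [k - i + 1 <= 2 (k - i)].  As [rate] is nondecreasing, a vertex of
    degree at most [D] has average share at most that of degree [D]; hence the
    average share for degree [D] is at least a quarter of the average share in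
    a full star. *)
Lemma star_average_bound n T (I : {set 'I_n}) (G : {set {set 'I_n}}) k r D : 0 < T ->
  G \subset pairs n -> [disjoint stars I & G] -> #|I| < k -> k + k <= n + 1 ->
  r <= n - 1 - k -> #|stars I| + #|G| = stars_size n k + r ->
  (forall v, deg G v <= D) ->
  lex_value n T k r <= int_count (stars I :|: G) T.+1 ->
  D * 'C(n - 1, T.+1) <= 2 * (n - 1 - #|I|) * \sum_(j < D) rate T #|I| j.
Proof.
move=> T0 sG GI Ik kn rn; rewrite card_stars_size; set i := #|I| in Ik * => cG degD hL.
have := lex_value_ge T r (ltnW Ik) kn; rewrite -cG addKn => hlow.
have hup := int_count_above_stars T0 sG GI; rewrite -/i in hup.
set R := \sum_(j < D) _.
have hR : D * \sum_v \sum_(j < deg G v) rate T i j <= 2 * #|G| * R.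
  rewrite -sum_deg // big_distrr big_distrl /=; apply: leq_sum => v _.
  by apply: sum_prefix_average => // a b; apply: rate_mono.
have hG : #|G| <= 2 * (k - i) * (n - 1 - i).
  have := stars_sizeB n (ltnW Ik).
  have : r <= (k - i) * (n - 1 - i).
    apply: leq_trans rn _; apply: leq_trans (_ : n - 1 - i <= _).
      by apply: leq_sub2l; apply: ltnW.
    by rewrite leq_pmull // subn_gt0.
  lia.
have k0 : 0 < k - i by rewrite subn_gt0.
have h1 : 2 * (k - i) * 'C(n - 1, T.+1) <= \sum_v \sum_(j < deg G v) rate T i j.
  rewrite -mulnA; move: hlow hup hL; move: (\sum_v _) (lex_value _ _ _ _) (int_count _ _).
  move: (stars_count _ _ _) ((T == 2) * i) ((k - i) * _) => s t x S L f.
  clear; nia.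
rewrite -(leq_pmul2l (m := 2 * (k - i))) ?muln_gt0 ?k0 //.
rewrite mulnCA; apply: leq_trans (_ : D * \sum_v \sum_(j < deg G v) rate T i j <= _).
  by rewrite leq_mul2l h1 orbT.
apply: leq_trans hR _; rewrite mulnA leq_mul2r; apply/orP; right.
by move: hG; move: (k - i) (n - 1 - i) #|G|; clear => *; lia.
Qed.

(** Compare the factors of the falling factorials:
    [(a - j) (b + s) <= (a + s) (b - j)]. *)
Lemma bin_pow a b s T : a <= b -> 'C(a, T) * (b + s) ^ T <= (a + s) ^ T * 'C(b, T).
Proof.
move=> ab; rewrite -(leq_pmul2r (fact_gt0 T)) -[_ * _ * _`!]mulnA [_ ^ _ * _`!]mulnC.
rewrite mulnA bin_ffact -mulnA bin_ffact; elim: T => [|T IH].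
  by rewrite !ffactn0 !expn0.
rewrite !ffactnSr !expnSr mulnACA [X in _ <= X]mulnACA; apply: leq_mul IH _.
case: (leqP a T) => aT; first by rewrite (eqP (_ : a - T == 0)) // subn_eq0.
nia.
Qed.

(** After cancelling one factor [N] and one factor [D] the hypothesis
    compares [C(N - 1, T)] with [C(D - 1, T)]. *)
Lemma degree_pow_bound c T N D : 1 < c -> T < N -> D <= N -> 0 < D ->
  (c - 1) * (D * 'C(N, T.+1)) <= 2 * c * N * (2 * 'C(D, T.+1)) ->
  (c - 1) * N ^ T <= 4 * c * D ^ T /\ T <= D.
Proof.
move=> c1; case: N => // N TN; case: D => // D DN _ h.
have CN : 0 < 'C(N, T) by rewrite bin_gt0.
have h1 : (c - 1) * 'C(N, T) <= 4 * c * 'C(D, T).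
  have := mul_bin_diag N.+1 T; have := mul_bin_diag D.+1 T => /= e1 e2.
  rewrite -(leq_pmul2l (m := D.+1 * N.+1)) //.
  suff -> : D.+1 * N.+1 * ((c - 1) * 'C(N, T)) = T.+1 * ((c - 1) * (D.+1 * 'C(N.+1, T.+1))).
    suff -> : D.+1 * N.+1 * (4 * c * 'C(D, T)) = T.+1 * (2 * c * N.+1 * (2 * 'C(D.+1, T.+1))).
      by rewrite leq_mul2l h orbT.
    transitivity (4 * c * N.+1 * (D.+1 * 'C(D, T))); first by lia.
    by rewrite e1; lia.
  transitivity ((c - 1) * D.+1 * (N.+1 * 'C(N, T))); first by lia.
  by rewrite e2; lia.
split; last first.
  suff : 0 < 'C(D, T) by rewrite bin_gt0 => /leqW.
  rewrite lt0n; apply: contraTneq h1 => ->.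
  by rewrite muln0 leqn0 muln_eq0 negb_or -!lt0n subn_gt0 c1.
rewrite -(leq_pmul2l CN).
have := @bin_pow D N 1 T DN; rewrite !addn1 => h2.
apply: leq_trans (_ : 4 * c * ('C(D, T) * N.+1 ^ T) <= _).
  by rewrite mulnA [_ * (c - 1)]mulnC mulnA leq_mul2r h1 orbT.
by rewrite [X in _ <= X]mulnC -[X in _ <= X]mulnA leq_mul2l h2 orbT.
Qed.

(** The same comparison for [T = 2], where [C(D, 2)] bounds the contribution
    of the triangles. *)
Lemma degree_square_bound N D : 16 <= N -> D <= N -> 0 < D ->
  3 * (D * 'C(N, 3)) <= 8 * N * (2 * 'C(D, 3) + 'C(D, 2)) ->
  3 * N ^ 2 <= 16 * D ^ 2.
Proof.
move=> N16 DN D0.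
have := bin_ffact N 3; have := bin_ffact D 3; have := bin_ffact D 2.
rewrite !ffactnS !ffactn0 !muln1 -[2`!]/2 -[3`!]/6.
move: 'C(N, 3) 'C(D, 3) 'C(D, 2) => x y z ez ey ex h.
have {}h : 3 * (D * (6 * x)) <= 8 * N * (2 * (6 * y) + 6 * z).
  by have := leq_mul (leqnn 6) h; clear; lia.
have {ex ey ez} : 3 * (D * (N * (N.-1 * N.-2))) <= 8 * N * (2 * (D * (D.-1 * D.-2)) + 3 * (D * D.-1)).
  have -> : N * (N.-1 * N.-2) = 6 * x by rewrite [RHS]mulnC -ex.
  have -> : D * (D.-1 * D.-2) = 6 * y by rewrite [RHS]mulnC -ey.
  have -> : 3 * (D * D.-1) = 6 * z by rewrite -ez; clear; lia.
  exact: h.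
case: N D N16 DN D0 {h} => [|[|N]] // [|D] // N16 DN _ /=.
move=> h.
have {}h : 3 * (N.+1 * N) <= 8 * (2 * (D * D.-1) + 3 * D).
  rewrite -(leq_pmul2l (m := D.+1 * N.+2)) //; lia.
have h2 : 3 * (N.+1 * N) <= 8 * (D * (2 * D + 1)) by case: D {DN} h => [|D] /=; lia.
rewrite leqNgt; apply/negP => h3.
have hD : 24 * D <= 9 * N by lia.
have hD2 : 48 * D + 24 <= 18 * N + 24 by lia.
by have := leq_mul hD hD2; lia.
Qed.

(** * Numerical consequences of the hypothesis *)

(** The averages are computed for the part of the degrees above the [i] full
    stars.  Passing from [M - i] to the degree [M] itself costs a factor
    [c / (c - 1)] when [M >= c i].  The hypothesis on [n] allows [c = 32] for [T = 1], where
    the final estimate is tightest, and [c = 4] for every other [T]. *)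
Definition slack T := if T == 1 then 32 else 4.

Lemma pow_hyp_pred T n l i : 64 * (4 * l) ^ T <= n ^ T -> i < l -> l <= n -> 0 < n ->
  64 * (4 * i) ^ T <= (n - 1) ^ T.
Proof.
move=> h il ln n0; have h1 : i * n <= l * (n - 1) by nia.
have {h1} : (i * n) ^ T <= (l * (n - 1)) ^ T by case: T {h} => // T; rewrite leq_exp2r.
rewrite !expnMn => h1; rewrite expnMn in h.
have nT : 0 < n ^ T by rewrite expn_gt0 n0.
rewrite -(leq_pmul2r nT); move: h h1.
move: (4 ^ T) (i ^ T) (n ^ T) (l ^ T) ((n - 1) ^ T) => a b c d e; clear => h h1.
have := leq_mul (leqnn (64 * a)) h1; have := leq_mul h (leqnn e); lia.
Qed.

Lemma four_lt T n l : 0 < T -> 0 < l -> 64 * (4 * l) ^ T <= n ^ T -> 4 * l < n.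
Proof.
move=> T0 l0 h; rewrite -(ltn_exp2r _ _ T0); apply: leq_trans h.
by rewrite ltn_Pmull // expn_gt0 muln_gt0 l0.
Qed.

(** The average bound is monotone in the degree, so it may be used at
    [M = max (i + D) (c i)], where losing [i] costs only the factor
    [c / (c - 1)].  The resulting lower bound on [M] excludes [c i > i + D]. *)
Lemma degree_lower_bound T n l i D : 0 < T -> T < n - 1 -> 1 < l -> i < l ->
  64 * (4 * l) ^ T <= n ^ T -> 0 < D -> i + D <= n - 1 ->
  (forall E, D <= E ->
     E * 'C(n - 1, T.+1) <= 2 * (n - 1 - i) * \sum_(j < E) rate T i j) ->
  (slack T - 1) * (n - 1) ^ T <= 4 * slack T * (i + D) ^ T /\ T <= i + D.
Proof.
move=> T0 Tn l1 il hl D0 Dn hE; set c := slack T.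
have ln := four_lt T0 (ltnW l1) hl.
have cn : c * i <= n - 1.
  rewrite /c /slack; case: eqP => [T1|_]; last by lia.
  by move: hl; rewrite T1 !expn1; lia.
have c1 : 1 < c by rewrite /c /slack; case: eqP.
set M := maxn (i + D) (c * i).
have Mn : M <= n - 1 by rewrite geq_max Dn.
have M0 : 0 < M by rewrite leq_max addn_gt0 D0 orbT.
have [E ME] : exists E, M = i + E.
  by exists (M - i); rewrite subnKC // leq_max leq_addr.
have DE : D <= E by rewrite -(leq_add2l i) -ME leq_maxl.
have cE : (c - 1) * M <= c * E.
  have : c * i <= M by apply: leq_maxr.
  by rewrite mulnBl mul1n; rewrite {1 3}ME; lia.
have hM : (c - 1) * (M * 'C(n - 1, T.+1)) <=
    2 * c * (n - 1) * (2 * 'C(M, T.+1) + (T == 2) * 'C(M, 2)).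
  rewrite mulnA; apply: leq_trans (_ : c * E * 'C(n - 1, T.+1) <= _).
    by rewrite leq_mul2r cE orbT.
  rewrite -mulnA; apply: leq_trans (_ : c * (2 * (n - 1 - i) * \sum_(j < E) rate T i j) <= _).
    by rewrite leq_mul2l hE ?orbT.
  rewrite mulnA; apply: leq_mul; first by lia.
  apply: leq_trans (_ : _ <= 2 * 'C(i + E, T.+1) + (T == 2) * 'C(E, 2)) _.
    by rewrite -sum_rate leq_addr.
  by rewrite -ME leq_add2l leq_mul2l leq_bin2l ?orbT // ME leq_addl.
have {hM} [hM TM] : (c - 1) * (n - 1) ^ T <= 4 * c * M ^ T /\ T <= M.
  case: (eqVneq T 2) hM => [T2|T2] hM; last first.
    apply: degree_pow_bound => //.
    by rewrite mul0n addn0 in hM.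
  move: hM; rewrite /c /slack T2 /= !mul1n => hM.
  (* in fact n >= 32 l, and l > 1 *)
  have n16 : 16 <= n - 1.
    move: hl; rewrite T2 => hl; rewrite leqNgt; apply/negP => n17.
    have : n ^ 2 <= 16 ^ 2 by rewrite leq_exp2r //; lia.
    have : 8 ^ 2 <= (4 * l) ^ 2 by rewrite leq_exp2r //; lia.
    by lia.
  have h := degree_square_bound n16 Mn M0 hM; split=> //.
  by move: h; case: (M) M0 => [|[|//]] // _; nia.
suff MD : M = i + D by rewrite -MD.
rewrite /M; case: (leqP (c * i) (i + D)) => [//|h].
have Mi : M = c * i by apply/maxn_idPr; apply: ltnW.
have i0 : 0 < i by case: (i) h; rewrite ?muln0.
have := pow_hyp_pred hl il _ _; rewrite (leq_trans _ (ltnW ln)) ?leq_pmull //.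
rewrite (leq_trans _ ln) // => /(_ isT isT) hi.
move: hM; rewrite Mi /c /slack; case: eqP => [T1|_].
  by move: hi; rewrite T1 !expn1; lia.
have : 0 < (n - 1) ^ T by rewrite expn_gt0 (leq_ltn_trans _ Tn).
by lia.
Qed.

Lemma pow_of_bin T D d : 0 < 'C(D, T) -> 'C(D, T) <= 2 * 'C(d, T) -> D ^ T <= 2 * d ^ T.
Proof.
move=> D0 Dd; case: (leqP d D) => [dD|/ltnW dD]; last first.
  apply: leq_trans (_ : d ^ T <= _); last by rewrite leq_pmull.
  by case: T {D0 Dd} => // T; rewrite leq_exp2r.
have d0 : 0 < 'C(d, T) by move: D0 Dd; case: ('C(d, T)) => //; rewrite muln0; lia.
rewrite -(leq_pmul2l d0); have := @bin_pow d D 0 T dD; rewrite !addn0 => /leq_trans; apply.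
by have := leq_mul (leqnn (d ^ T)) Dd; lia.
Qed.

Lemma bin_lt_third T b d : 1 < T -> 9 * b <= 5 * d -> 0 < 'C(d, T) -> 3 * 'C(b, T) < 'C(d, T).
Proof.
move=> T1 bd d0; have b_d : b <= d by lia.
have d_gt0 : 0 < d by case: d d0 {bd b_d} => //; rewrite bin0n; case: T T1.
have := @bin_pow b d 0 T b_d; rewrite !addn0 => h.
have h9 : 9 ^ T * b ^ T <= 5 ^ T * d ^ T.
  by rewrite -!expnMn; case: T {T1 d0 h} => // T; rewrite leq_exp2r.
have h35 : 3 * 5 ^ T < 9 ^ T.
  case: T T1 {d0 h h9} => [|[|T]] // _; elim: T => // T IH.
  by rewrite !(expnS _ T.+2); lia.
have dT : 0 < d ^ T by rewrite expn_gt0 d_gt0.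
have h9T : 0 < 9 ^ T by rewrite expn_gt0.
move: h h9 h35 dT h9T d0; move: ('C(b, T)) ('C(d, T)) (9 ^ T) (5 ^ T) (b ^ T) (d ^ T).
clear => x y n f p q h1 h2 h3 q0 n0 y0.
rewrite -(ltn_pmul2l q0) -(ltn_pmul2l n0).
have := leq_mul (leqnn (3 * n)) h1; have := leq_mul h2 (leqnn (3 * y)).
have : 3 * f * (q * y) < n * (q * y) by rewrite ltn_pmul2r ?muln_gt0 ?q0.
lia.
Qed.

(** The degree bound makes [d ^ 2] comparable to [n ^ 2], while [m] is at most
    [l n].  The constants combine to [9 * 64 ^ T <= 16 * 45 ^ T] if the conclusion
    fails, which is false for [T >= 2]. *)
Lemma few_edges T n l d m : 1 < T -> 0 < d -> 8 < n ->
  64 * (4 * l) ^ T <= n ^ T -> m <= l * (n - 1) ->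
  3 * (n - 1) ^ T <= 32 * d ^ T -> 5 * m <= 2 * d ^ 2.
Proof.
move=> T1 d0 n8 hl hm hd; rewrite leqNgt; apply/negP => md.
have T0 : 0 < T by apply: ltnW.
have h1 : m ^ T <= l ^ T * (n - 1) ^ T by rewrite -expnMn leq_exp2r.
have h2 : 8 ^ T * n ^ T <= 9 ^ T * (n - 1) ^ T by rewrite -!expnMn leq_exp2r //; lia.
have h3 : 2 ^ T * (d ^ T * d ^ T) <= 5 ^ T * m ^ T.
  by rewrite -!expnMn leq_exp2r // mulnn ltnW.
have h4 : 16 * (5 ^ T * 9 ^ T) < 9 * (4 ^ T * 8 ^ T * 2 ^ T).
  rewrite -!expnMn; case: T T1 {hl hd T0 h1 h2 h3} => [|[|T]] // _; elim: T => // T IH.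
  by rewrite !(expnS _ T.+2); lia.
have dT : 0 < d ^ T by rewrite expn_gt0 d0.
rewrite expnMn in hl; move: hl hd h1 h2 h3 h4 dT.
move: (4 ^ T) (8 ^ T) (2 ^ T) (5 ^ T) (9 ^ T) (l ^ T) (n ^ T) ((n - 1) ^ T) (d ^ T) (m ^ T).
clear => a e b f g L N A q p hl hd h1 h2 h3 h4 q0.
have k1 : 64 * a * e * p <= g * (A * A).
  apply: leq_trans (_ : 64 * a * e * (L * A) <= _); first by rewrite leq_mul2l h1 orbT.
  have := leq_mul (leq_mul hl (leqnn e)) (leqnn A); have := leq_mul h2 (leqnn A); lia.
have k2 : 9 * (A * A) <= 1024 * (q * q) by have := leq_mul hd hd; lia.
have k3 : 9 * (64 * a * e * p) * f <= g * (1024 * (q * q)) * f.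
  rewrite leq_mul2r; apply/orP; right.
  have := leq_mul (leqnn 9) k1; have := leq_mul (leqnn g) k2; lia.
have k4 : 9 * 64 * a * e * (b * (q * q)) <= 9 * 64 * a * e * (f * p) by rewrite leq_mul2l h3 orbT.
have k5 : 16 * (f * g) * (64 * (q * q)) < 9 * (a * e * b) * (64 * (q * q)).
  by rewrite ltn_pmul2r // !muln_gt0 q0.
lia.
Qed.

(** With [x = b / d], the two edge counts read [x <= 2 m / d ^ 2] and
    [x (1 - x / 2) < m / d ^ 2].  For [T = 1] one has [m / d ^ 2 <= 5 / 18], which
    forces [x < 1 / 3].  For [T >= 2] one has [m / d ^ 2 <= 2 / 5], which forces
    [x <= 5 / 9]; this suffices because [3 (5 / 9) ^ T < 1]. *)
Lemma cover_small T n l D d b m : 0 < T -> 1 < l -> 64 * (4 * l) ^ T <= n ^ T ->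
  (slack T - 1) * (n - 1) ^ T <= 4 * slack T * D ^ T ->
  0 < 'C(D, T) -> 'C(D, T) <= 2 * 'C(d, T) -> m <= l * (n - 1) ->
  b * d <= 2 * m -> 2 * (b * d) <= 2 * m + b * b.-1 ->
  3 * 'C(b, T) < 'C(d, T).
Proof.
move=> T0 l1 hl hD D0 Dd hm bd1 bd2.
have ln := four_lt T0 (ltnW l1) hl.
have dT := pow_of_bin D0 Dd.
have d0 : 0 < 'C(d, T) by move: D0 Dd; case: ('C(d, T)) => //; rewrite muln0; lia.
have d_gt0 : 0 < d by case: d d0 {bd1 bd2 Dd dT} => //; rewrite bin0n; case: T T0 {hl hD D0}.
case: (ltnP 1 T) => [T1|T1]; last first.
  have T1' : T = 1 by lia.
  move: hl hD dT; rewrite T1' !bin1 !expn1 /slack /= => hl hD dT.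
  have dn : 31 * (n - 1) <= 256 * d by lia.
  have mn : 256 * m <= n * (n - 1).
    by apply: leq_trans (_ : 256 * (l * (n - 1)) <= _); [lia | nia].
  have md : 18 * m <= 5 * (d * d).
    have := leq_mul dn dn; nia.
  rewrite ltnNge; apply/negP => h; case: b bd1 bd2 h => [|b] /= bd1 bd2 h; first by lia.
  (* excludes the other root 5 / 3 of 18 x ^ 2 - 36 x + 10 *)
  have h59 : 9 * b.+1 <= 5 * d.
    rewrite -(leq_pmul2r d_gt0); lia.
  nia.
have md : 5 * m <= 2 * d ^ 2.
  apply: (few_edges T1 d_gt0 _ hl hm); first by lia.
  by move: hD; rewrite /slack (gtn_eqF T1) /=; lia.
rewrite -mulnn in md.
apply: bin_lt_third => //; rewrite leqNgt; apply/negP => h.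
(* the quadratic inequality also holds for large x; b d <= 2 m excludes these *)
have h45 : 5 * b <= 4 * d by rewrite -(leq_pmul2r d_gt0); lia.
have : 2 * (b * d) <= 2 * m + b * b.
  by apply: leq_trans bd2 _; rewrite leq_add2l leq_mul2l leq_pred orbT.
by move: md h h45; clear; nia.
Qed.

Lemma card_set_uniq (U : finType) (s : seq U) : uniq s -> #|[set:: s]| = size s.
Proof. by move=> /card_uniqP <-; apply: eq_card => x; rewrite inE. Qed.

Lemma exists_subset_card (U : finType) (A : {set U}) k : k <= #|A| ->
  exists X : {set U}, X \subset A /\ #|X| = k.
Proof.
move=> kA; exists [set:: take k (enum A)]; split.
  by apply/subsetP => x; rewrite inE => /mem_take; rewrite mem_enum.
by rewrite card_set_uniq ?take_uniq ?enum_uniq // size_takel // -cardE.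
Qed.

(** * Maximal graphs *)

Lemma degS n (G H : {set {set 'I_n}}) u : G \subset H -> deg G u <= deg H u.
Proof. by move=> GH; rewrite (degD u GH) leq_addr. Qed.

Lemma gain_le T a b c : 0 < T -> c <= minn a b ->
  'C(a, T) + 'C(b, T) + (T == 2) * c <= 2 * 'C((maxn a b).+1, T).
Proof.
case: T => // T _ hc; rewrite binS.
have ha : 'C(a, T.+1) <= 'C(maxn a b, T.+1) by apply: leq_bin2l; apply: leq_maxl.
have hb : 'C(b, T.+1) <= 'C(maxn a b, T.+1) by apply: leq_bin2l; apply: leq_maxr.
have : (T.+1 == 2) * c <= 'C(maxn a b, T).
  by case: eqP => [[->]|//]; rewrite bin1 mul1n; lia.
lia.
Qed.

(** Replacing [uv] by [wx] gains at least [C(deg w, T)], and what it loses is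
    bounded through the larger of the degrees of [u] and [v]. *)
Lemma swap_edge n T (G : {set {set 'I_n}}) (u v w x : 'I_n) : 0 < T ->
  G \subset pairs n ->
  (forall H : {set {set 'I_n}}, H \subset pairs n -> #|H| = #|G| ->
     int_count H T.+1 <= int_count G T.+1) ->
  w != x -> [set w; x] \notin G -> [set u; v] \in G -> w \notin [set u; v] ->
  'C(deg G w, T) <= 2 * 'C(maxn (deg G u) (deg G v), T).
Proof.
move=> T0 sG opt wx wxG uvG we.
have uv : u != v by have := subsetP sG _ uvG; rewrite pair_in_pairs.
set K := G :\ [set u; v].
have GE : G = [set u; v] |: K by rewrite setD1K.
have uvK : [set u; v] \notin K by rewrite !inE eqxx.
have sK : K \subset pairs n by apply: subset_trans sG; apply: subD1set.
have wxK : [set w; x] \notin K by rewrite !inE (negbTE wxG) andbF.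
have := opt ([set w; x] |: K); rewrite subUset sub1set pair_in_pairs wx sK.
rewrite cardsU1 wxK [in #|G|]GE cardsU1 uvK => /(_ isT erefl).
rewrite GE !int_countU // leq_add2l degU_in // degU_inr // degU_out //.
rewrite maxnSS => h; apply: leq_trans (_ : gain K T w x <= _).
  by rewrite /gain -addnA leq_addr.
by apply: leq_trans h _; apply: gain_le => //; apply: codeg_le.
Qed.

(** The trapezoidal rule overestimates the sum of a convex sequence. *)
Lemma trapezoid T a s :
  2 * \sum_(j < s) 'C(a + j, T) <= s * ('C(a, T) + 'C(a + s, T)).
Proof.
elim: s => [|s IH]; first by rewrite big_ord0.
have hs : s.+1 * 'C(a + s, T) <= 'C(a, T) + s * 'C(a + s.+1, T).
  elim: s {IH} => [|s IH]; first by rewrite addn0 mul0n addn0 mul1n.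
  have := @bin_convex T (a + s) (a + s.+1) 1; rewrite !addn1 -!addnS leq_add2l leqnSn.
  move=> /(_ isT) h; have := leq_mul (leqnn s.+1) h.
  move: IH h; move: 'C(a + s, T) 'C(a + s.+1, T) 'C(a + s.+2, T) 'C(a, T) => x y z t.
  clear; lia.
have : 'C(a + s, T) <= 'C(a + s.+1, T) by apply: leq_bin2l; lia.
rewrite big_ord_recr /=; move: IH hs; move: (\sum_(_ < _) _) => S.
move: 'C(a + s, T) 'C(a + s.+1, T) 'C(a, T) => x y t; clear; nia.
Qed.

(** The edges from [w] to the outside of [B] are replaced by edges that meet
    [B] elsewhere.  Each new edge gains at least [C(d, T)], where [d] is the degree
    of [w].  The old ones were worth, by the trapezoidal rule, on average at
    most the mean of [C(d, T)] and [C(#|B|, T)], plus [C(#|B|, T)] for the outer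
    endpoint. *)
Lemma shift_edges n T (G : {set {set 'I_n}}) (B : {set 'I_n}) (w : 'I_n) : 0 < T ->
  G \subset stars B -> w \in B -> (forall u, u \in B -> deg G w <= deg G u) ->
  3 * 'C(#|B|, T) < 'C(deg G w, T) -> #|G| <= #|stars (B :\ w)| ->
  exists H : {set {set 'I_n}},
    [/\ H \subset pairs n, #|H| = #|G| & int_count G T.+1 < int_count H T.+1].
Proof.
move=> T0 GB wB dmin hb hG.
have sG : G \subset pairs n := subset_trans GB (stars_sub B).
set d := deg G w in dmin hb *; set S := stars (B :\ w) in hG *; set K := G :&: S.
have KG : K \subset G := subsetIl _ _.
have KS : K \subset S := subsetIr _ _.
set s := #|G :\: K|.
have cG : #|G| = #|K| + s by apply: cardsD_sub.
have wE u v : [set u; v] \in G -> [set u; v] \notin K -> w \in [set u; v].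
  move=> uvG; apply: contraR; rewrite 2!inE negb_or in_set1 => /andP[wu wv].
  rewrite inE uvG pair_in_stars.
  by have := subsetP GB _ uvG; rewrite pair_in_stars !inE ![_ == w]eq_sym wu wv.
have dw : d = deg K w + s.
  rewrite /d (degD w KG) -[deg (G :\: K) w]card_star; last exact: subset_trans (subsetDl _ _) sG.
  congr (_ + _); apply/eq_card => e; rewrite inE andb_idr // inE => /andP[eK eG].
  have := subsetP sG _ eG; rewrite inE => /cards2P[u [v [uv eE]]].
  by rewrite eE in eK eG *; apply: wE.
have aB : deg K w <= #|B|.-1.
  rewrite (cardsD1 w B) wB add1n /=; apply/subset_leq_card/subsetP => x.
  by rewrite inE => /(subsetP KS); rewrite pair_in_stars !inE eqxx => /andP[_].
(* rebuild G from K: all the edges added contain w *)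
have upper (H : {set {set 'I_n}}) : K \subset H -> H \subset pairs n -> H \subset G ->
    int_count H T.+1 <= int_count K T.+1 +
      \sum_(j < deg H w - deg K w) ('C(deg K w + j, T) + 'C(#|B|, T)).
  move: H; apply: graph_ind => [_|H u v KH sH uv uvH IH].
    by rewrite subnn big_ord0 addn0.
  rewrite subUset sub1set => /andP[uvG HG].
  have wuv : w \in [set u; v] by apply: wE; rewrite // (contra (subsetP KH _)).
  have [x xw xE] : exists2 x, x != w & [set u; v] = [set w; x].
    by apply: pairE wuv; apply: (subsetP sG).
  rewrite xE in uvH uvG *; have {}IH := IH HG.
  have wx : w != x by rewrite eq_sym.
  have le_w := degS w KH.
  rewrite int_countU // degU_in // subSn // big_ord_recr /= addnA.
  apply: leq_add IH _; rewrite subnKC // /gain -addnA leq_add2l.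
  have xB : deg H x < #|B|.
    have xB : x \notin B.
      have : [set w; x] \notin K by apply: contra uvH; apply: (subsetP KH).
      by rewrite inE uvG pair_in_stars wx !inE eqxx xw.
    rewrite (cardsD1 w B) wB ltnS; apply/subset_leq_card/subsetP => y yx.
    rewrite !inE; apply/andP; split.
      by apply: contraNneq uvH => <-; rewrite setUC; move: yx; rewrite inE.
    have := subsetP GB [set x; y]; rewrite pair_in_stars (negbTE xB) /=.
    by rewrite (subsetP HG) => [/(_ isT)/andP[]//|]; rewrite inE in yx.
  have hc : #|nbhd H w :&: nbhd H x| <= deg H x.
    by apply: leq_trans (codeg_le _ _ _) (geq_minr _ _).
  case: (#|B|) xB => // b xb; case: (T) T0 => // T' _; rewrite binS.
  have h1 : 'C(deg H x, T'.+1) <= 'C(b, T'.+1) by apply: leq_bin2l.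
  apply: leq_add h1 _; case: eqP => [[->]|//]; rewrite bin1 mul1n.
  exact: leq_trans hc _.
(* add to K edges that meet B outside w *)
have lower (H : {set {set 'I_n}}) : K \subset H -> H \subset pairs n -> H \subset S ->
    int_count K T.+1 + (#|H| - #|K|) * 'C(d, T) <= int_count H T.+1.
  move: H; apply: graph_ind => [_|H u v KH sH uv uvH IH].
    by rewrite subnn mul0n addn0.
  have deg_ge y : y \in B :\ w -> d <= deg H y.
    move=> yB; apply: leq_trans (_ : deg G y <= _).
      by apply: dmin; move: yB; rewrite inE => /andP[].
    apply: leq_trans (degS y KH); apply/subset_leq_card/subsetP => z.
    rewrite inE => yz; rewrite inE in_setI yz pair_in_stars yB andbT.
    by have := subsetP sG _ yz; rewrite pair_in_pairs.
  rewrite subUset sub1set => /andP[uvS HS].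
  have {}IH := IH HS; rewrite int_countU // cardsU1 uvH add1n subSn ?subset_leq_card //.
  rewrite mulSn addnCA addnC; apply: leq_add IH _.
  move: uvS; rewrite pair_in_stars => /andP[_ /orP[/deg_ge h|/deg_ge h]].
    by rewrite /gain -addnA; apply: leq_trans (leq_addr _ _); apply: leq_bin2l.
  rewrite /gain; apply: leq_trans (leq_addr _ _); apply: leq_trans (leq_addl _ _).
  exact: leq_bin2l.
have [X [XS cX]] : exists X : {set {set 'I_n}}, X \subset S :\: K /\ #|X| = s.
  apply: exists_subset_card; rewrite -(leq_add2l #|K|) -cG.
  by rewrite -(cardsD_sub KS).
have hd : #|B| < d.
  rewrite ltnNge; apply/negP => /(leq_bin2l T) h; have := leq_trans hb h.
  by rewrite ltnNge leq_pmull.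
have aB' : deg K w <= #|B| by apply: leq_trans aB (leq_pred _).
have s0 : 0 < s.
  by rewrite -(ltn_add2l (deg K w)) addn0 -dw; apply: leq_ltn_trans hd.
exists (K :|: X).
have KX : #|K :|: X| = #|K| + s.
  rewrite cardsU cX (_ : K :&: X = set0) ?cards0 ?subn0 //.
  apply/setP => e; rewrite !in_set0 in_setI; apply/negbTE/negP => /andP[eK /(subsetP XS)].
  by rewrite inE eK.
have XS' : K :|: X \subset S.
  by rewrite subUset KS; apply: subset_trans XS (subsetDl _ _).
have sX : K :|: X \subset pairs n := subset_trans XS' (stars_sub _).
split; [by [] | by rewrite KX cG | ].
apply: leq_trans (lower _ (subsetUl _ _) sX XS').
have ds : d - deg K w = s by rewrite dw addKn.
have := upper G KG sG (subxx _); rewrite -/d ds.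
have -> : \sum_(j < s) ('C(deg K w + j, T) + 'C(#|B|, T)) =
    \sum_(j < s) 'C(deg K w + j, T) + s * 'C(#|B|, T).
  by rewrite big_split /= sum_nat_const card_ord.
rewrite KX addKn => up; apply: leq_ltn_trans up _; rewrite ltn_add2l.
have := trapezoid T (deg K w) s; rewrite -dw.
have : 'C(deg K w, T) <= 'C(#|B|, T) by apply: leq_bin2l.
move: hb s0; move: (\sum_(j < s) 'C(deg K w + j, T)) 'C(#|B|, T) 'C(d, T) 'C(deg K w, T) (s).
clear => R y z x s hb s0 xy hR.
have : s * (x + z + 2 * y) < s * (2 * z) by rewrite ltn_pmul2l //; lia.
lia.
Qed.

Lemma stars_size_le n a b : a <= b -> stars_size n a <= stars_size n b.
Proof.
move=> /subnKC <-; elim: (b - a) => [|d IH]; first by rewrite addn0.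
by rewrite addnS [X in _ <= X]big_ord_recr /=; apply: leq_trans IH (leq_addr _ _).
Qed.

Lemma deg_le n (G : {set {set 'I_n}}) u : G \subset pairs n -> deg G u <= n - 1.
Proof.
move=> sG; rewrite -[n in _ <= n - 1]card_ord subn1 -(cardsC1 u).
apply/subset_leq_card/subsetP => x /(nbhd_neq sG); by rewrite !inE eq_sym.
Qed.

(** No star has [T + 1] edges, and a triangle has only three. *)
Lemma int_count_eq0 n T (G : {set {set 'I_n}}) : n - 1 <= T -> 2 < T ->
  G \subset pairs n -> int_count G T.+1 = 0.
Proof.
move=> nT T2 sG; have T0 : 0 < T by case: T T2 {nT}.
have d0 : [disjoint stars (set0 : {set 'I_n}) & G].
  rewrite -setI_eq0; apply/eqP/setP => e; rewrite !inE set0I eqxx.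
  by rewrite andbF.
have s0 : stars (set0 : {set 'I_n}) = set0.
  by apply/setP => e; rewrite !inE set0I eqxx andbF.
have := int_count_above_stars T0 sG d0; rewrite s0 set0U cards0.
rewrite /stars_count big_ord0 muln0 !muln0 mul0n !add0n big1 => [|v _].
  by rewrite leqn0 muln_eq0 /= => /eqP.
rewrite big1 // => j _; rewrite /rate add0n (gtn_eqF T2) bin_small //.
by apply: leq_trans (ltn_ord j) _; apply: leq_trans (deg_le _ sG) nT.
Qed.

(** Unless [n - 1 <= T], where the count vanishes, a maximiser has [k] full
    vertices or a vertex cover of size [k + 1]. *)
Lemma optimal_le_lex_value n T l k r (G : {set {set 'I_n}}) : 0 < T ->
  64 * (4 * l) ^ T <= n ^ T -> k < l -> 0 < r -> r <= n - 1 - k ->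
  G \subset pairs n -> #|G| = stars_size n k + r ->
  (forall H : {set {set 'I_n}}, H \subset pairs n -> #|H| = #|G| ->
     int_count H T.+1 <= int_count G T.+1) ->
  lex_value n T k r <= int_count G T.+1 ->
  int_count G T.+1 <= lex_value n T k r.
Proof.
move=> T0 hl kl r0 rn sG cG opt hL.
set I := [set v | deg G v == n - 1].
have sI : stars I \subset G.
  apply/subsetP => e; rewrite inE => /andP[ep /set0Pn[u]].
  rewrite inE => /andP[uI ue]; have [x xu ->] := pairE ep ue.
  have : nbhd G u = [set~ u].
    apply/eqP; rewrite eqEcard cardsC1 card_ord -subn1.
    move: uI; rewrite inE /deg => /eqP ->; rewrite leqnn andbT.
    by apply/subsetP => y /(nbhd_neq sG); rewrite !inE eq_sym.
  by move/setP/(_ x); rewrite !inE xu.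
case: (leqP k #|I|) => [kI|Ik].
  have [J [JI cJ]] := exists_subset_card kI.
  have sJ : stars J \subset G := subset_trans (starsS JI) sI.
  have := int_count_le_full T0 sJ sG; rewrite cJ cG card_stars_size cJ.
  by rewrite addKn.
have k0 : 0 < k by apply: leq_ltn_trans Ik.
have l1 : 1 < l := leq_ltn_trans k0 kl.
have ln := four_lt T0 (ltnW l1) hl.
case: (ltnP T (n - 1)) => [Tn|nT]; last first.
  by rewrite int_count_eq0 //; lia.
(* w is a vertex of largest degree among those that are not full *)
set K := G :\: stars I.
have sK : K \subset pairs n := subset_trans (subsetDl _ _) sG.
have GE : stars I :|: K = G by rewrite /K -[X in X :|: _](setIidPr sI) setID.
have dK : [disjoint stars I & K].
  by rewrite disjoint_sym disjoints_subset subsetDr.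
have cK : #|stars I| + #|K| = stars_size n k + r by rewrite -cG -cardsD_sub.
have n0 : 0 < #|'I_n| by rewrite card_ord; lia.
have [w Ew] := eq_bigmax (deg K) n0.
set D := deg K w in Ew.
have degD' v : deg K v <= D by rewrite -Ew; apply: leq_bigmax.
have D0 : 0 < D.
  have : 0 < #|K|.
    rewrite -(ltn_add2l #|stars I|) addn0 cK card_stars_size.
    apply: leq_ltn_trans (stars_size_le n (ltnW Ik)) _.
    by rewrite -[X in X < _]addn0 ltn_add2l.
  case/card_gt0P=> e eK; have := subsetP sK _ eK.
  rewrite inE => /cards2P[u [v [uv eE]]]; apply: leq_trans (degD' u).
  by apply/card_gt0P; exists v; rewrite inE -eE.
have wI : w \notin I.
  apply/negP => wI; have := degD w sI; rewrite deg_stars wI -/K -/D.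
  move: wI; rewrite inE => /eqP -> /eqP.
  by rewrite -[X in X == _]addn0 eqn_add2l (ltn_eqF D0).
have dw : deg G w = #|I| + D by rewrite (degD w sI) deg_stars (negbTE wI).
have dwn : deg G w < n - 1.
  by rewrite ltn_neqAle deg_le // andbT; move: wI; rewrite inE.
have [x wx wxG] : exists2 x, w != x & [set w; x] \notin G.
  have /existsP[x] : [exists x, (w != x) && ([set w; x] \notin G)].
    apply: contraLR dwn; rewrite negb_exists => /forallP h; rewrite -leqNgt.
    rewrite -[n in n - 1 <= _]card_ord subn1 -(cardsC1 w); apply/subset_leq_card/subsetP => x.
    by rewrite !inE eq_sym => wx; have := h x; rewrite wx negbK.
  by case/andP=> wx wxG; exists x.
(* the second part makes C(deg w, T) positive *)
have [hD TD] : (slack T - 1) * (n - 1) ^ T <= 4 * slack T * deg G w ^ T /\ T <= deg G w.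
  rewrite dw; apply: degree_lower_bound Tn l1 _ hl D0 _ _ => //.
  - exact: leq_ltn_trans (ltnW Ik) kl.
  - by rewrite -dw ltnW.
  move=> E DE; apply: star_average_bound cK _ _ => //.
  - by clear -ln kl; lia.
  - by move=> v; apply: leq_trans (degD' v) DE.
  by rewrite GE.
set d0 := deg G w in hD TD dw dwn.
set B := [set v | 'C(d0, T) <= 2 * 'C(deg G v, T)].
have wB : w \in B by rewrite inE leq_pmull.
have GB : G \subset stars B.
  apply/subsetP => e eG; have := subsetP sG _ eG.
  rewrite inE => /cards2P[u [v [uv eE]]]; rewrite eE in eG *.
  rewrite pair_in_stars uv /=; apply: contraT; rewrite negb_or => /andP[uB vB].
  have we : w \notin [set u; v].
    by rewrite !inE negb_or; apply/andP; split; apply: contraTneq wB => ->.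
  have := swap_edge T0 sG opt wx wxG eG we.
  by case: (leqP (deg G u) (deg G v)) => _ h; [move: vB|move: uB]; rewrite inE h.
case: (leqP #|B| k.+1) => bk.
  have [C [BC cC]] : exists C : {set 'I_n}, B \subset C /\ #|C| = k.+1.
    have : k.+1 - #|B| <= #|~: B|.
      rewrite [#|~: B|]cardsCs setCK card_ord leq_sub2r //; clear -ln kl; lia.
    case/exists_subset_card=> X [XB cX]; exists (B :|: X); split; first exact: subsetUl.
    rewrite cardsU cX (_ : B :&: X = set0) ?cards0 ?subn0 ?subnKC //.
    by apply/eqP; rewrite setI_eq0 disjoint_sym disjoints_subset.
  have GC : G \subset stars C := subset_trans GB (starsS BC).
  apply: (int_count_le_cover T0 GC cC r0).
  have := cardsD_sub GC; rewrite card_stars_size cC cG /stars_size big_ord_recr /=.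
  by move/eqP; rewrite -addnA eqn_add2l => /eqP ->.
have [w1 w1B w1min] : exists2 w1, w1 \in B & forall u, u \in B -> deg G w1 <= deg G u.
  by case: (arg_minnP (deg G) wB) => w1 h1 h2; exists w1.
set b := #|B| in bk; set d := deg G w1 in w1min.
have hb : b * d <= \sum_(v in B) deg G v.
  by rewrite -sum_nat_const; apply: leq_sum => v /w1min.
have hm : #|G| <= l * (n - 1).
  rewrite cG; apply: leq_trans (_ : k * (n - 1) + (n - 1) <= _).
    apply: leq_add; last by apply: leq_trans rn (leq_subr _ _).
    rewrite -[k in k * _]card_ord -sum_nat_const; apply: leq_sum => h _; apply: leq_subr.
  by rewrite addnC -mulSn leq_mul2r kl orbT.
have hthird : 3 * 'C(b, T) < 'C(d, T).
  apply: (cover_small T0 l1 hl hD _ _ hm).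
  - by rewrite bin_gt0.
  - by move: w1B; rewrite inE.
  - apply: leq_trans hb _; rewrite -sum_deg // big_mkcond /=.
    by apply: leq_sum => v _; case: ifP.
  apply: leq_trans (_ : 2 * (#|G| + 'C(b, 2)) <= _).
    by rewrite leq_mul2l /=; apply: leq_trans hb (sum_deg_in_le _ sG).
  rewrite mulnDr leq_add2l bin2 mul2n -[X in _ <= X]odd_double_half.
  exact: leq_addl.
have hroom : #|G| <= #|stars (B :\ w1)|.
  have cB1 : #|B :\ w1| = b.-1 by rewrite /b (cardsD1 w1 B) w1B.
  rewrite card_stars_size cB1; apply: leq_trans (stars_size_le n (_ : k.+1 <= _)).
    by rewrite cG /stars_size big_ord_recr /= leq_add2l.
  by move: bk; case: (b).
have [H [sH cH]] := shift_edges T0 GB w1B w1min hthird hroom.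
by rewrite ltnNge opt.
Qed.

(** * Lexicographic graphs *)

Lemma lex_ltP n (A B : {set 'I_n}) :
  reflect (exists i : 'I_n, [/\ i \in A, i \notin B &
             forall j : 'I_n, j < i -> (j \in A) = (j \in B)])
          (lex_lt A B).
Proof.
have symE j : (j \in symdiff A B) = ((j \in A) != (j \in B)).
  by rewrite !inE; case: (j \in A); case: (j \in B).
apply: (iffP existsP) => [[i /andP[/andP[iS /forall_inP min] iA]]|[i [iA iB agree]]].
  exists i; split=> // [|j ji].
    by move: iS; rewrite symE iA; case: (i \in B).
  apply/eqP; apply: contraTT ji => h; rewrite -leqNgt; apply: min.
  by rewrite symE.
exists i; rewrite iA andbT /is_min symE iA (negbTE iB) /=.
apply/forall_inP => j; rewrite symE; apply: contraR; rewrite -ltnNge => /agree ->.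
by rewrite eqxx.
Qed.

Lemma lex_le_anti n : antisymmetric (@lex_le n).
Proof.
move=> A B /andP[/orP[/eqP//|/lex_ltP[i [iA iB hi]]]].
case/orP=> [/eqP//|/lex_ltP[j [jB jA hj]]].
case: (ltngtP i j) => ij.
- by rewrite (hj _ ij) iA in iB.
- by rewrite (hi _ ij) jB in jA.
by rewrite (val_inj ij) jB in iB.
Qed.

Lemma lex_le_trans n : transitive (@lex_le n).
Proof.
move=> B A C /orP[/eqP->//|AB] /orP[/eqP<-|BC]; first by rewrite /lex_le AB orbT.
apply/orP; right; case/lex_ltP: AB => i [iA iB hi]; case/lex_ltP: BC => j [jB jC hj].
apply/lex_ltP; case: (ltngtP i j) => ij.
- exists i; split=> // [|h hi']; first by rewrite -(hj _ ij).
  by rewrite hi // hj // (ltn_trans hi').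
- exists j; split=> // [|h hj']; first by rewrite (hi _ ij).
  by rewrite hi ?hj // (ltn_trans hj').
by rewrite (val_inj ij) jB in iB.
Qed.

Lemma lex_le_total n : total (@lex_le n).
Proof.
move=> A B; case: (eqVneq A B) => [->|AB]; first by rewrite /lex_le eqxx.
have /existsP[i0 hi0] : [exists i, (i \in A) != (i \in B)].
  apply: contraNT AB; rewrite negb_exists => /forallP h; apply/eqP/setP => i.
  by apply/eqP; have := h i; rewrite negbK.
have [i hi imin] := @arg_minnP _ i0 (fun i => (i \in A) != (i \in B)) (@nat_of_ord n) hi0.
have agree (j : 'I_n) : j < i -> (j \in A) = (j \in B).
  by move=> ji; apply/eqP; apply: contraTT ji => h; rewrite -leqNgt imin.
move: hi; case: (boolP (i \in A)) => iA; case: (boolP (i \in B)) => iB // _.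
  by apply/orP; left; apply/orP; right; apply/lex_ltP; exists i; split.
apply/orP; right; apply/orP; right; apply/lex_ltP; exists i; split=> //.
by move=> j /agree.
Qed.

Lemma lex_graph_sub n m : lex_graph n m \subset pairs n.
Proof.
by apply/subsetP => e; rewrite inE => /mem_take; rewrite mem_sort mem_enum.
Qed.

Lemma card_lex_graph n m : m <= 'C(n, 2) -> #|lex_graph n m| = m.
Proof.
move=> mn; rewrite card_set_uniq ?take_uniq ?sort_uniq ?enum_uniq //.
by rewrite size_takel // size_sort -cardE card_pairs.
Qed.

(** The sorted list of all pairs starts with the sorted list of [L]. *)
Lemma lex_graph_initial n (L : {set {set 'I_n}}) : L \subset pairs n ->
  (forall a b, a \in L -> b \in pairs n -> b \notin L -> lex_lt a b) ->
  lex_graph n #|L| = L.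
Proof.
move=> sL hL; rewrite /lex_graph.
set le := @lex_le n.
have -> : sort le (enum (pairs n)) = sort le (enum L) ++ sort le (enum (pairs n :\: L)).
  apply: (sorted_eq (@lex_le_trans n) (@lex_le_anti n)).
  - exact: sort_sorted (@lex_le_total n) _.
  - rewrite (sorted_pairwise (@lex_le_trans n)) pairwise_cat.
    rewrite -!(sorted_pairwise (@lex_le_trans n)) !sort_sorted ?andbT; try exact: lex_le_total.
    apply/allrelP => a b; rewrite !mem_sort !mem_enum => aL.
    by rewrite inE => /andP[bL bp]; rewrite /lex_le hL ?orbT.
  rewrite perm_sort perm_sym; apply: uniq_perm; rewrite ?enum_uniq //.
    rewrite cat_uniq !sort_uniq !enum_uniq andbT /=.
    apply/hasPn => b; rewrite !mem_sort !mem_enum inE => /andP[]//.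
  move=> e; rewrite mem_cat !mem_sort !mem_enum inE.
  by case: (boolP (e \in L)) => //= /(subsetP sL) ->.
rewrite take_cat size_sort -cardE ltnn subnn take0 cats0.
by apply/setP => e; rewrite inE mem_sort mem_enum.
Qed.

Lemma card_initial n k : k <= n -> #|[set v : 'I_n | v < k]| = k.
Proof.
move=> kn; have -> : [set v : 'I_n | v < k] = [set widen_ord kn i | i : 'I_k].
  apply/setP => v; rewrite inE; apply/idP/imsetP => [vk|[i _ ->]]; last by rewrite /= ltn_ord.
  by exists (Ordinal vk) => //; apply: val_inj.
by rewrite card_imset ?card_ord // => i j /(congr1 val) /= /val_inj.
Qed.

Lemma card_interval n k r : k + r < n -> #|[set v : 'I_n | k < v <= k + r]| = r.
Proof.
move=> krn.
have := cardsID [set v : 'I_n | v < k.+1] [set v : 'I_n | v < (k + r).+1].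
rewrite [RHS]card_initial // (_ : _ :&: _ = [set v : 'I_n | v < k.+1]); last first.
  by apply/setP => v; rewrite !inE; lia.
rewrite card_initial; last by lia.
rewrite (_ : _ :\: _ = [set v : 'I_n | k < v <= k + r]); last first.
  by apply/setP => v; rewrite !inE; lia.
lia.
Qed.

Lemma lex_graphE n k r (a : 'I_n) : a = k :> nat -> k + r < n ->
  lex_graph n (stars_size n k + r) =
    stars [set v : 'I_n | v < k] :|: fan a [set v : 'I_n | k < v <= k + r].
Proof.
move=> ak krn; set A := [set v : 'I_n | v < k]; set X := [set v : 'I_n | _ < v <= _].
have aA : a \notin A by rewrite inE ak ltnn.
have aX : a \notin X by rewrite inE ak ltnn.
have cA : #|A| = k by rewrite card_initial //; lia.
have cX : #|X| = r by apply: card_interval.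
have cL : #|stars A :|: fan a X| = stars_size n k + r.
  rewrite cardsU card_stars_size cA (_ : stars A :&: fan a X = set0); last first.
    apply/setP => e; rewrite in_set0 in_setI; apply/negbTE/negP.
    case/andP=> eA /imsetP[x xX ex]; move: eA; rewrite ex pair_in_stars (negbTE aA) /=.
    by rewrite !inE in xX *; lia.
  rewrite cards0 subn0 card_in_imset ?cX // => x y xX _.
  by apply: pair_injl; apply: contraNneq aX => ->.
rewrite -cL; apply: lex_graph_initial; first exact: stars_fan_sub.
move=> e b eL bp bL.
have bk j : j \in b -> k <= j.
  move=> jb; rewrite leqNgt; apply: contra bL => jk.
  rewrite in_setU inE bp /=; apply/orP; left; apply/set0Pn; exists j.
  by rewrite !inE jk.
case/setUP: eL.
  rewrite inE => /andP[ep /set0Pn[u]]; rewrite !inE => /andP[uk ue].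
  have [i ie imin] := @arg_minnP _ u (fun i => i \in e) (@nat_of_ord n) ue.
  have ik : i < k by apply: leq_ltn_trans uk; apply: imin.
  apply/lex_ltP; exists i; split=> // [|j ji].
    by apply: contraTN ik => /bk; rewrite -leqNgt.
  have -> : (j \in b) = false.
    by apply: contraTF ji => /bk jk; rewrite -leqNgt (leq_trans (ltnW ik)).
  by apply: contraTF ji => je; rewrite -leqNgt imin.
case/imsetP=> v vX ->; have := vX; rewrite inE => /andP[kv vr].
case: (boolP (a \in b)) => ab; last first.
  apply/lex_ltP; exists a; split=> //; first by rewrite !inE eqxx.
  move=> j; rewrite ak => jk; rewrite !inE -!val_eqE /= ak.
  have -> : (j \in b) = false by apply: contraTF jk => /bk; rewrite -leqNgt.
  by apply/negbTE; lia.
(* both pairs contain k, so the second elements decide *)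
have [y ya yb] := pairE bp ab.
have yv : v < y.
  have /bk yk : y \in b by rewrite yb !inE eqxx orbT.
  have yX : y \notin X.
    apply: contra bL => yX; rewrite in_setU; apply/orP; right.
    by apply/imsetP; exists y.
  move: yX ya; rewrite inE -val_eqE /= ak => h1 h2; lia.
apply/lex_ltP; exists v; split; first by rewrite !inE eqxx orbT.
  by rewrite yb !inE -!val_eqE /= ak; lia.
by move=> j jv; rewrite yb !inE -!val_eqE /=; lia.
Qed.

Lemma int_count_lex n T k r : 0 < T -> k + r < n ->
  int_count (lex_graph n (stars_size n k + r)) T.+1 = lex_value n T k r.
Proof.
move=> T0 krn; have kn : k < n by apply: leq_ltn_trans krn; apply: leq_addr.
have cA : #|[set v : 'I_n | v < k]| = k by rewrite card_initial // ltnW.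
rewrite (@lex_graphE _ _ _ (Ordinal kn)) // int_count_fan //; last first.
- by rewrite disjoints_subset; apply/subsetP => v; rewrite !inE => /andP[/ltnW]; rewrite leqNgt.
- by rewrite inE /= ltnn.
- by rewrite inE /= ltnn.
by rewrite int_count_stars // cA card_interval.
Qed.

Lemma stars_size_split n l m : 0 < m -> m <= stars_size n l ->
  exists k r, [/\ k < l, 0 < r, r <= n - 1 - k & m = stars_size n k + r].
Proof.
move=> m0; elim: l => [|l IH] ml.
  by move: ml; rewrite /stars_size big_ord0 leqNgt m0.
case: (leqP m (stars_size n l)) => [/IH[k [r [kl r0 rn mE]]]|lm].
  by exists k, r; split=> //; apply: ltnW.
exists l, (m - stars_size n l); split=> //; first by rewrite subn_gt0.
  by rewrite leq_subLR; move: ml; rewrite /stars_size big_ord_recr.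
by rewrite subnKC // ltnW.
Qed.

Lemma int_count_exp0 n (G : {set {set 'I_n}}) : int_count G 0 = 1.
Proof.
rewrite -(cards1 (set0 : {set {set 'I_n}})); congr #|pred_of_set _|.
apply/setP => F; rewrite !inE cards_eq0; case: eqP => [->|_]; rewrite ?andbF //.
by rewrite sub0set /=; apply/intersectingP => A B; rewrite inE.
Qed.

Lemma int_count_exp1 n (G : {set {set 'I_n}}) : G \subset pairs n ->
  int_count G 1 = #|G|.
Proof.
move=> sG; rewrite -[RHS]bin1 -cards_draws; congr #|pred_of_set _|.
apply/setP => F; rewrite !inE; apply/andb_id2l => FG; apply/andb_idr => /cards1P[e Fe].
apply/intersectingP => A B; rewrite Fe !inE => /eqP-> /eqP->.
have : e \in pairs n by apply: (subsetP sG); apply: (subsetP FG); rewrite Fe inE.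
rewrite inE => /eqP e2; have /card_gt0P[x xe] : 0 < #|e| by rewrite e2.
by exists x.
Qed.

(** * The theorem *)

Import Order.TTheory GRing.Theory Num.Theory.

(** Raise the hypothesis to the power [T]: the exponent becomes [2 T + 6]. *)
Lemma nat_hypothesis (R : realType) (T n l : nat) : 0 < T ->
  ((2 : R) `^ (2 + 6 / (T.+1%:R - 1)) * l%:R <= n%:R :> R)%R ->
  64 * (4 * l) ^ T <= n ^ T.
Proof.
move=> T0; rewrite -[(T.+1%:R)%R]natr1 addrK => h.
have TR : (T%:R != 0 :> R)%R by rewrite pnatr_eq0 -lt0n.
have := lerXn2r T _ _ h; rewrite !nnegrE mulr_ge0 ?powR_ge0 ?ler0n // => /(_ isT isT).
rewrite exprMn -powR_mulrn ?powR_ge0 // -powRrM.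
have -> : ((2 + 6 / T%:R) * T%:R = (6 + 2 * T)%:R :> R)%R.
  by rewrite mulrDl divfK // natrD natrM addrC.
rewrite powR_mulrn // -!natrX -natrM ler_nat; apply: leq_trans.
by rewrite expnD expnM expnMn mulnA.
Qed.

Theorem proposition2p1 (R : realType) (t n l : nat)
  (hn : (1 <= n)%N)
  (hl : t <> 1%N ->
     ((2 : R) `^ (2 + 6 / (t%:R - 1)) * l%:R <= n%:R :> R)%R)
  (m : nat) (hm : (m <= 'C(n, 2) - 'C(n - l, 2))%N) :
  [/\ lex_graph n m \subset pairs n,
      #|lex_graph n m| = m &
      forall G : {set {set 'I_n}}, G \subset pairs n -> #|G| = m ->
        (int_count G t <= int_count (lex_graph n m) t)%N].
Proof.
have cL : #|lex_graph n m| = m.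
  by apply: card_lex_graph; apply: leq_trans hm (leq_subr _ _).
split=> //; first exact: lex_graph_sub.
move=> G sG cG; case: t hl => [|[|t]] hl; first by rewrite !int_count_exp0.
  by rewrite !int_count_exp1 ?lex_graph_sub // cL cG.
set T := t.+1 in hl *; have T0 : 0 < T by [].
have {}hl : 64 * (4 * l) ^ T <= n ^ T by apply: nat_hypothesis T0 (hl _).
case: (posnP m) => [m0|m0].
  rewrite (cards0_eq (etrans cG m0)).
  by rewrite (cards0_eq (etrans cL m0)).
have l0 : 0 < l.
  by case: l hm {hl} => //; rewrite subn0 subnn leqNgt m0.
have ln := four_lt T0 l0 hl.
rewrite -stars_sizeE in hm; last by lia.
have [k [r [kl r0 rn mE]]] := stars_size_split m0 hm.
have kr : k + r < n by lia.
pose P (H : {set {set 'I_n}}) := (H \subset pairs n) && (#|H| == m).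
have PL : P (lex_graph n m) by rewrite /P lex_graph_sub cL eqxx.
have [M /andP[sM /eqP cM] maxM] := @arg_maxnP _ _ P (fun H => int_count H T.+1) PL.
have fL : int_count (lex_graph n m) T.+1 = lex_value n T k r by rewrite mE int_count_lex.
apply: leq_trans (_ : int_count M T.+1 <= _); first by apply: maxM; rewrite /P sG cG eqxx.
rewrite fL; apply: (optimal_le_lex_value T0 hl kl r0 rn sM); first by rewrite cM.
  by move=> H sH cH; apply: maxM; rewrite /P sH cH cM eqxx.
by rewrite -fL; apply: maxM.
Qed.
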